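(* Let $M$ be a connected matroid on the ground set $[n]$, $n\geq 2$. Then $M$ is a split matroid if and only if for each split flacet $F$ of $M$ the restriction $M|F$ and the contraction $M/F$ both are uniform matroids.
   Context: Let $M$ be a matroid of rank $d$ on $[n]$ with rank function $\operatorname{rk}$. The matroid polytope $P(M)\subset\mathbb{R}^n$ is the convex hull of the characteristic vectors of the bases of $M$; it is contained in the hypersimplex $\Delta(d,n)=P(U_{d,n})=[0,1]^n\cap\{\sum_i x_i=d\}$. For a flat $F$, let $P_M(F)=\{x\in P(M):\sum_{i\in F}x_i=\operatorname{rk}(F)\}$. A flacet of $M$ is a flat $F$ such that $P_M(F)$ is a facet of $P(M)$ and $F$ is minimal with respect to inclusion among all flats defining the same facet. The $F$-hyperplane is given by $(d-\operatorname{rk}(F))\sum_{i\in F}x_i=\operatorname{rk}(F)\sum_{j\notin F}x_j$, equivalently (on $\sum_i x_i=d$) by $\sum_{i\in F}x_i=\operatorname{rk}(F)$. A split of a polytope $P$ is a polytopal subdivision of $P$ (without new vertices) with exactly two maximal cells; its split hyperplane is the affine span of the common codimension-one cell. A split flacet of $M$ is a flacet $F$ such that the $F$-hyperplane defines a split of $\Delta(d,n)$. Two splits of a polytope $P$ are compatible if their split hyperplanes do not meet in a relatively interior point of $P$. The matroid $M$ is a split matroid if its split flacets form a compatible system of splits of the polytope $\operatorname{aff}(P(M))\cap[0,1]^n$, i.e. for any two distinct split flacets $F,G$ the $F$-hyperplane and the $G$-hyperplane do not meet in a relatively interior point of $\operatorname{aff}(P(M))\cap[0,1]^n$. If $M$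 is connected then $\operatorname{aff}(P(M))\cap[0,1]^n=\Delta(d,n)$. *)

(* Defs.v *)
From mathcomp Require Import all_boot all_order all_algebra.
From mathcomp Require Import boolp classical_sets cardinality reals topology normedtype.

Set Implicit Arguments.
Unset Strict Implicit.
Unset Printing Implicit Defensive.

Import Order.TTheory GRing.Theory Num.Theory.
Import numFieldNormedType.Exports.

Record matroid (T : finType) := Matroid {
  rk :> {set T} -> nat;
  rk_card : forall A : {set T}, (rk A <= #|A|)%N;
  rk_mono : forall A B : {set T}, A \subset B -> (rk A <= rk B)%N;
  rk_submod : forall A B : {set T},
    (rk (A :|: B) + rk (A :&: B) <= rk A + rk B)%N }.

Section Matroid.
Variables (T : finType) (M : matroid T).
Implicit Types A B F : {set T}.

Definition rank : nat := rk M [set: T].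

Definition is_basis B : bool := (rk M B == #|B|) && (#|B| == rank).

Definition flat F : bool := [forall e, (e \notin F) ==> (rk M F < rk M (e |: F))%N].

(* M is the direct sum of its restrictions to A and to the complement of A. *)
Definition separator A : Prop :=
  forall X : {set T}, rk M X = (rk M (X :&: A) + rk M (X :\: A))%N.

Definition connected_matroid : Prop :=
  forall A, A != finset.set0 -> A != [set: T] -> ~ separator A.

Definition uniform_matroid : Prop :=
  forall B, #|B| = rank -> is_basis B.

End Matroid.

Section Minors.
Variables (T : finType) (M : matroid T) (F : {set T}).

Let rT := {x : T | x \in F}.
Let cT := {x : T | x \notin F}.

Definition rk_restriction (A : {set rT}) : nat := rk M [set val x | x in A].

Lemma restriction_card (A : {set rT}) : (rk_restriction A <= #|A|)%N.
Proof. by rewrite -(card_imset (mem A) val_inj) rk_card. Qed.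

Lemma restriction_mono (A B : {set rT}) :
  A \subset B -> (rk_restriction A <= rk_restriction B)%N.
Proof. by move=> AB; apply: rk_mono; apply: imsetS. Qed.

Lemma restriction_submod (A B : {set rT}) :
  (rk_restriction (A :|: B) + rk_restriction (A :&: B)
   <= rk_restriction A + rk_restriction B)%N.
Proof.
by rewrite /rk_restriction imsetU imsetI ?rk_submod // => x y _ _; apply: val_inj.
Qed.

Definition restriction : matroid rT :=
  Matroid restriction_card restriction_mono restriction_submod.

Definition rk_contraction (A : {set cT}) : nat :=
  (rk M ([set val x | x in A] :|: F) - rk M F)%N.

Lemma contraction_card (A : {set cT}) : (rk_contraction A <= #|A|)%N.
Proof.
rewrite leq_subLR addnC -(card_imset (mem A) val_inj).
apply: leq_trans (leq_add (rk_card M _) (leqnn _)).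
by apply: leq_trans (rk_submod M _ _); apply: leq_addr.
Qed.

Lemma contraction_mono (A B : {set cT}) :
  A \subset B -> (rk_contraction A <= rk_contraction B)%N.
Proof. by move=> AB; apply: leq_sub2r; apply/rk_mono/finset.setSU/imsetS. Qed.

Lemma contraction_submod (A B : {set cT}) :
  (rk_contraction (A :|: B) + rk_contraction (A :&: B)
   <= rk_contraction A + rk_contraction B)%N.
Proof.
have leF (X : {set T}) : (rk M F <= rk M (X :|: F))%N.
  by apply/rk_mono/finset.subsetUr.
rewrite /rk_contraction imsetU imsetI; last by move=> x y _ _; apply: val_inj.
set X := imset _ _; set Y := imset _ _.
rewrite -(leq_add2r (rk M F + rk M F)) addnACA !subnK // addnACA !subnK //.
by rewrite finset.setUIl -{1}(finset.setUid F) finset.setUACA rk_submod.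
Qed.

Definition contraction : matroid cT :=
  Matroid contraction_card contraction_mono contraction_submod.

End Minors.

Local Open Scope classical_set_scope.
Local Open Scope ring_scope.

Section Polytopes.
Variables (R : realType) (n : nat).
Local Notation V := 'rV[R]_n.
Implicit Types (P Q H : set V) (C : set (set V)).

Definition convex_hull P : set V :=
  [set x : V | exists (k : nat) (p : 'I_k -> V) (w : 'I_k -> R),
     [/\ forall i, P (p i), forall i, 0 <= w i, \sum_i w i = 1 &
         x = \sum_i w i *: p i]].

Definition affine_hull P : set V :=
  [set x : V | exists (k : nat) (p : 'I_k -> V) (w : 'I_k -> R),
     [/\ forall i, P (p i), \sum_i w i = 1 & x = \sum_i w i *: p i]].

Definition polytope P : Prop := exists s : seq V, P = convex_hull [set` s].

Definition relint P : set V :=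
  [set x | P x /\ \forall y \near x, affine_hull P y -> P y].

Definition affinely_independent k (p : 'I_k -> V) : Prop :=
  forall w : 'I_k -> R,
    \sum_i w i = 0 -> \sum_i w i *: p i = 0 -> forall i, w i = 0.

(* The affine hull of P has dimension k - 1; so k = 0 iff P is empty, which
   gives the empty set dimension -1. *)
Definition affine_rank P (k : nat) : Prop :=
  exists p : 'I_k -> V,
    [/\ forall i, P (p i), affinely_independent p & P `<=` affine_hull (range p)].

Definition codim_one Q P : Prop :=
  exists k : nat, affine_rank Q k /\ affine_rank P k.+1.

(* Taking c = 0, both the empty set and P itself are faces of P. *)
Definition face Q P : Prop :=
  exists (c : V) (b : R),
    (forall x, P x -> \sum_i c 0 i * x 0 i <= b) /\
    Q = [set x | P x /\ \sum_i c 0 i * x 0 i = b].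

Definition facet Q P : Prop := face Q P /\ codim_one Q P.

Definition vertex (v : V) P : Prop := face [set v] P.

Definition polytopal_subdivision C P : Prop :=
  [/\ finite_set C,
      forall Q, C Q -> polytope Q,
      forall Q Q', C Q -> face Q' Q -> C Q',
      forall Q Q', C Q -> C Q' -> face (Q `&` Q') Q /\ face (Q `&` Q') Q' &
      \bigcup_(Q in C) Q = P].

Definition no_new_vertices C P : Prop :=
  forall Q v, C Q -> vertex v Q -> vertex v P.

Definition maximal_cell C Q : Prop :=
  C Q /\ forall Q', C Q' -> Q `<=` Q' -> Q' = Q.

Definition is_split C P (Q1 Q2 : set V) : Prop :=
  [/\ polytopal_subdivision C P, no_new_vertices C P, Q1 <> Q2 &
      forall Q, maximal_cell C Q <-> Q = Q1 \/ Q = Q2].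

(* P need not be full-dimensional: the split hyperplane is a hyperplane of the
   affine hull of P, and H defines the split when it cuts out that hyperplane. *)
Definition defines_split H P : Prop :=
  exists C Q1 Q2,
    [/\ is_split C P Q1 Q2, codim_one (Q1 `&` Q2) P &
        affine_hull (Q1 `&` Q2) = H `&` affine_hull P].

Definition compatible (H1 H2 : set V) P : Prop :=
  ~ exists x, [/\ relint P x, H1 x & H2 x].

Definition unit_cube : set V := [set x : V | forall i, 0 <= x 0 i <= 1].

Definition hypersimplex (d : nat) : set V :=
  unit_cube `&` [set x : V | \sum_i x 0 i = d%:R].

End Polytopes.

Section SplitMatroids.
Variables (R : realType) (n : nat) (M : matroid 'I_n).
Local Notation V := 'rV[R]_n.
Implicit Types F G : {set 'I_n}.

Definition char_vec (B : {set 'I_n}) : V := \row_i (i \in B)%:R.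

Definition matroid_polytope : set V :=
  convex_hull [set char_vec B | B in [set B | is_basis M B]].

Definition flat_face F : set V :=
  matroid_polytope `&` [set x : V | \sum_(i in F) x 0 i = (rk M F)%:R].

Definition flacet F : Prop :=
  [/\ flat M F, facet (flat_face F) matroid_polytope &
      forall G, flat M G -> flat_face G = flat_face F -> G \subset F -> G = F].

Definition flat_hyperplane F : set V :=
  [set x : V | ((rank M)%:R - (rk M F)%:R) * \sum_(i in F) x 0 i =
                   (rk M F)%:R * \sum_(j in ~: F) x 0 j].

Definition split_flacet F : Prop :=
  flacet F /\ defines_split (flat_hyperplane F) (@hypersimplex R n (rank M)).

Definition split_matroid : Prop :=
  forall F G, split_flacet F -> split_flacet G -> F <> G ->
    compatible (flat_hyperplane F) (flat_hyperplane G)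
      (affine_hull matroid_polytope `&` @unit_cube R n).

End SplitMatroids.

(* Main.v *)
(* Write conn(X, Y) for "the minor M | Y / X is connected", which can be said purely
   in terms of modular pairs of sets for the rank function.  Counting affinely
   independent bases shows that F defines a facet exactly when conn(0, F) and
   conn(F, [n]), and the F-hyperplane splits the hypersimplex exactly when it has
   points of the hypersimplex strictly on both sides, i.e. 0 < rk F < #|F| and
   0 < d - rk F < n - #|F|.

   If M | F (or M / F) is not uniform, it contains a further set A with all three
   minors of the chain connected; this chain is a ridge of the matroid polytope,
   and the second facet through that ridge is a split flacet whose hyperplane
   meets the F-hyperplane at a point that is constant on the blocks of the chain.
   Conversely, if M | F and M / F are uniform and F is not contained in G, then
   F :&: G is independent and F :|: G is spanning or free over F, and
   submodularity leaves no room for an interior point of the hypersimplex on both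
   hyperplanes. *)
Require Import Defs.
From mathcomp Require Import all_boot all_order all_algebra.
From mathcomp Require Import reals.
From mathcomp Require Import boolp classical_sets cardinality topology normedtype.
From mathcomp Require Import zify ring lra.
(* Restores the names shadowed by classical_sets and normedtype. *)
From mathcomp Require Import fintype finset.
Require Import Defs.

Set Implicit Arguments.
Unset Strict Implicit.
Unset Printing Implicit Defensive.

Import Order.TTheory GRing.Theory Num.Theory.
Import numFieldNormedType.Exports.

(** * Connected minors and ridges *)

(** Connectedness is phrased through modular pairs because only the submodular defect enters: the
    notion makes sense for every submodular function, complementing sets then stands in for duality,
    and contractions reduce to the ridge argument for restrictions. The further set in a nonuniform
    minor grows out of a circuit: circuits are connected, and a maximal connected set of deficient
    rank has a connected quotient. Facets and splits, however, are defined by convex geometry. For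
    [n >= 2] connectedness forces positive rank, so the hyperplane on which all coordinates sum to
    the rank misses the origin and affine ranks become matrix ranks. A split needs an actual
    subdivision without new vertices; it exists because cutting a hypersimplex at an integer value
    of a coordinate sum creates 0/1 vertices only. In the converse the inequalities leave one tight
    case, where [F] and [G] are complementary and modular; connectedness of [M] itself excludes
    it. *)

Ltac setdec_at x :=
  repeat match goal with
  | H : _ = _ |- _ => move/setP/(_ x): H
  | H : is_true (_ \subset _) |- _ => move/setIidPl/setP/(_ x): H
  end;
  rewrite ?inE;
  repeat match goal with |- context [x \in ?A] => case: (x \in A) end;
  by [].
(** Inclusions are read as equations [A :&: B = A], so goal and context become statements about one
    point, settled by a truth table. *)
Ltac setdec := let x := fresh "x" in
  first [apply/setP => x | apply/setIidPl/setP => x]; setdec_at x.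

Section Submodular.
Variables (T : finType) (f : {set T} -> nat).
Hypothesis f_submod : forall A B : {set T}, f (A :|: B) + f (A :&: B) <= f A + f B.
Implicit Types X Y Z S U A F G : {set T}.

(* For a matroid rank function and X \subset Y this says that the minor
   M | Y / X is connected. *)
Definition connected_between X Y : Prop :=
  forall S U, S :&: U = X -> S :|: U = Y -> f S + f U = f X + f Y ->
    S = X \/ U = X.

Lemma connected_between_refl X : connected_between X X.
Proof. by move=> S U SU_I SU_U _; left; setdec. Qed.

(** The four submodular inequalities below add up to the assumed equality, so each of them is
    tight. *)
Lemma modular_restrict X Y Z S U : X \subset Z -> Z \subset Y ->
  S :&: U = X -> S :|: U = Y -> f S + f U = f X + f Y ->
  f (S :&: Z) + f (U :&: Z) = f X + f Z /\ f (S :|: Z) + f (U :|: Z) = f Z + f Y.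
Proof.
move=> XZ ZY SU_X SU_Y modSU.
have := f_submod S Z; have := f_submod U Z.
have := f_submod (S :&: Z) (U :&: Z); have := f_submod (S :|: Z) (U :|: Z).
have -> : (S :&: Z) :&: (U :&: Z) = X by setdec.
have -> : (S :&: Z) :|: (U :&: Z) = Z by setdec.
have -> : (S :|: Z) :&: (U :|: Z) = Z by setdec.
have -> : (S :|: Z) :|: (U :|: Z) = Y by setdec.
lia.
Qed.

(** A modular pair is trivial on each of the two steps of the chain, which leaves two times two
    cases. Hence the only possible separation of the whole interval is by [Z] itself. *)
Lemma connected_betweenP X Y Z S U : X \subset Z -> Z \subset Y ->
  S :&: U = X -> S :|: U = Y -> f S + f U = f X + f Y ->
  connected_between X Z -> connected_between Z Y ->
  [\/ S = X, U = X, S = X :|: (Y :\: Z) /\ U = Z | U = X :|: (Y :\: Z) /\ S = Z].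
Proof.
move=> XZ ZY SU_X SU_Y modSU conXZ conZY.
have [modI modU] := modular_restrict XZ ZY SU_X SU_Y modSU.
have [] := conXZ (S :&: Z) (U :&: Z) _ _ modI; [setdec | setdec | |] => eqX.
  have [] := conZY (S :|: Z) (U :|: Z) _ _ modU; [setdec | setdec | |] => eqZ.
    by constructor 1; setdec.
  by constructor 3; split; setdec.
have [] := conZY (S :|: Z) (U :|: Z) _ _ modU; [setdec | setdec | |] => eqZ.
  by constructor 4; split; setdec.
by constructor 2; setdec.
Qed.

(* Geometrically, the chain A \subset F is a ridge of the polytope, and the
   conclusion describes the facet through it other than that of F. *)
Lemma ridge_above A F : A \subset F -> A != set0 -> F != setT -> F != set0 ->
  connected_between set0 A -> connected_between A F ->
  connected_between F setT -> connected_between set0 setT ->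
  connected_between A setT \/
  [/\ f (A :|: ~: F) + f F = f A + f setT,
      connected_between set0 (A :|: ~: F) & connected_between (A :|: ~: F) setT].
Proof.
move=> AF A0 FT F0 con0A conAF conFT con0T.
have [modD|nmodD] := eqVneq (f (A :|: ~: F) + f F) (f A + f setT); last first.
  (* The only candidate for a separation above [A] is [F] against [A :|: ~: F], which is not modular
     here. *)
  left=> S U SU_A SU_T modSU.
  case: (connected_betweenP AF (subsetT F) SU_A SU_T modSU conAF conFT); auto.
  - case=> eqS eqU; case/eqP: nmodD; rewrite -modSU eqU eqS; congr (f _ + _).
    by setdec.
  case=> eqU eqS; case/eqP: nmodD; rewrite -modSU eqU eqS addnC; congr (_ + f _).
  by setdec.
right; split=> // S U.
- move=> SU0 SUAD modSU.
  have AAD : A \subset A :|: ~: F by rewrite subsetUl.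
  (* Since [F] and [A :|: ~: F] are modular over [A], joining with [F] carries a separation of this
     interval to one between [F] and [setT]. *)
  have conA : connected_between A (A :|: ~: F).
    move=> S' U' SU'A SU'AD modSU'.
    have := f_submod S' F; have := f_submod U' F.
    have := f_submod (S' :|: F) (U' :|: F).
    have -> : S' :&: F = A by setdec.
    have -> : U' :&: F = A by setdec.
    have <- : F = (S' :|: F) :&: (U' :|: F) by setdec.
    have -> : (S' :|: F) :|: (U' :|: F) = setT by setdec.
    move=> sub1 sub2 sub3; have [] := conFT (S' :|: F) (U' :|: F).
    + by setdec.
    + by setdec.
    + lia.
    + by move=> eqF; left; setdec.
    by move=> eqF; right; setdec.
  (* The one separation left is [~: F] against [A]; by modularity it would make [~: F] against [F] a
     separation of the whole ground set. *)
  have absurd S' U' : S' = set0 :|: ((A :|: ~: F) :\: A) -> U' = A ->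
      f S' + f U' = f set0 + f (A :|: ~: F) -> False.
    move=> eqS eqU modS'; have [] := con0T S' F.
    + by setdec.
    + by rewrite eqS; setdec.
    + by rewrite eqU in modS'; lia.
    + move=> S0; case/eqP: FT; move: S0; rewrite eqS => S0; setdec.
    by move/eqP: F0.
  case: (connected_betweenP (sub0set A) AAD SU0 SUAD modSU con0A conA); auto.
  + by case=> eqS eqU; case: (absurd _ _ eqS eqU).
  by case=> eqU eqS; case: (absurd _ _ eqU eqS); rewrite addnC.
(* Conversely, intersecting with [F] carries a separation above [A :|: ~: F] to one between [A] and
   [F]. *)
move=> SU_AD SU_T modSU.
have := f_submod S F; have := f_submod U F.
have := f_submod (A :|: ~: F) (S :&: F); have := f_submod (A :|: ~: F) (U :&: F).
have := f_submod (S :&: F) (U :&: F).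
have -> : (S :&: F) :&: (U :&: F) = A by setdec.
have -> : (S :&: F) :|: (U :&: F) = F by setdec.
have -> : S :|: F = setT by setdec.
have -> : U :|: F = setT by setdec.
have -> : (A :|: ~: F) :|: (S :&: F) = S by setdec.
have -> : (A :|: ~: F) :|: (U :&: F) = U by setdec.
have -> : (A :|: ~: F) :&: (S :&: F) = A by setdec.
have -> : (A :|: ~: F) :&: (U :&: F) = A by setdec.
move=> sub1 sub2 sub3 sub4 sub5; have [] := conAF (S :&: F) (U :&: F).
- by setdec.
- by setdec.
- lia.
- by move=> eqA; left; setdec.
by move=> eqA; right; setdec.
Qed.

End Submodular.

(** * Duality by complementation *)

Section Dual.
Variables (T : finType) (f : {set T} -> nat).
Hypothesis f_submod : forall A B : {set T}, f (A :|: B) + f (A :&: B) <= f A + f B.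
Implicit Types X Y Z S U A F G : {set T}.

(** For a matroid rank function this is the dual rank up to the modular term [#|X|] and a constant,
    neither of which affects modular pairs. It is decreasing, which is why the ridge argument
    assumes submodularity alone. *)
Let g X := f (~: X).

Let g_submod A B : g (A :|: B) + g (A :&: B) <= g A + g B.
Proof. by rewrite /g setCU setCI addnC f_submod. Qed.

Let connected_between_dual X Y :
  connected_between f X Y -> connected_between g (~: Y) (~: X).
Proof.
move=> con S U SU_Y SU_X; rewrite /g !setCK => modSU.
by have [||||] := con (~: S) (~: U); [setdec | setdec | lia | |] => eqX;
  [right | left]; setdec.
Qed.

Let connected_between_codual X Y :
  connected_between g (~: Y) (~: X) -> connected_between f X Y.
Proof.
move=> con S U SU_X SU_Y modSU.
by have [||||] := con (~: S) (~: U); [setdec | setdec | rewrite /g !setCK; lia | |] => eqX;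
  [right | left]; setdec.
Qed.

(** This is [ridge_above] for the complementary chain [~: G], [~: F]; the complement of [~: G :|: F]
    is [G :\: F]. *)
Lemma ridge_below F G : F \subset G -> F != set0 -> F != setT -> G != setT ->
  connected_between f set0 F -> connected_between f F G ->
  connected_between f G setT -> connected_between f set0 setT ->
  connected_between f set0 G \/
  [/\ f (G :\: F) + f F = f G + f set0,
      connected_between f set0 (G :\: F) & connected_between f (G :\: F) setT].
Proof.
move=> FG F0 FT GT con0F conFG conGT con0T.
have [||||||||con|[]] := @ridge_above _ g g_submod (~: G) (~: F).
- by rewrite setCS.
- by apply: contraNneq GT => eq0; apply/eqP; setdec.
- by apply: contraNneq F0 => eq0; apply/eqP; setdec.
- by apply: contraNneq FT => eq0; apply/eqP; setdec.
- by rewrite -setCT; apply: connected_between_dual.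
- exact: connected_between_dual.
- by rewrite -setC0; apply: connected_between_dual.
- by have := connected_between_dual con0T; rewrite setC0 setCT.
- by left; apply: connected_between_codual; rewrite setC0.
have eqGF : ~: G :|: ~: ~: F = ~: (G :\: F) by setdec.
rewrite eqGF /g !setCK setCT => modF con1 con2; right; split=> //.
  by apply: connected_between_codual; rewrite setC0.
by apply: connected_between_codual; rewrite setCT.
Qed.

End Dual.

(** * Matroids *)

Section MatroidTheory.
Variables (T : finType) (M : matroid T).
Implicit Types A B C I J S U X Y F G : {set T}.

Lemma rk_set0 : rk M set0 = 0.
Proof. by apply/eqP; rewrite -leqn0 -(cards0 T) rk_card. Qed.

Lemma rk_setU_card A B : rk M (A :|: B) <= rk M A + #|B|.
Proof. by have := rk_submod M A B; have := rk_card M B; lia. Qed.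

Lemma rk_subset_card A B : A \subset B -> rk M B <= rk M A + #|B :\: A|.
Proof. by move=> AB; rewrite -{1}(setID B A) (setIidPr AB) rk_setU_card. Qed.

Lemma rk_setU_eq J X :
  (forall e, e \in X -> rk M (e |: J) = rk M J) -> rk M (J :|: X) = rk M J.
Proof.
move: {2}#|X| (erefl #|X|) => m; elim: m X => [|m IH] X.
  by move/eqP; rewrite cards_eq0 => /eqP->; rewrite setU0.
move=> cX spanX; have [e eX] : exists e, e \in X by apply/card_gt0P; rewrite cX.
have eqX' : rk M (J :|: X :\ e) = rk M J.
  apply: IH; first by move: cX; rewrite (cardsD1 e) eX => -[].
  by move=> a; rewrite !inE => /andP[_ /spanX].
have := rk_submod M (J :|: X :\ e) (e |: J); rewrite (spanX e eX) eqX'.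
have -> : J :|: X :\ e :|: (e |: J) = J :|: X.
  apply/setP=> x; rewrite !inE; have [->|_] := eqVneq x e.
    by rewrite eX !orbT.
  by rewrite orbAC orbb.
have := rk_mono M (subsetUl J X).
have : rk M J <= rk M ((J :|: X :\ e) :&: (e |: J)).
  by apply: rk_mono; rewrite subsetI subsetUl subsetUr.
lia.
Qed.

Lemma indep_subset A B : A \subset B -> rk M B = #|B| -> rk M A = #|A|.
Proof.
move=> AB rkB; have := rk_subset_card AB; rewrite rkB -(cardsID A B).
by rewrite (setIidPr AB); have := rk_card M A; lia.
Qed.

Lemma indep_extend I X : I \subset X -> rk M I = #|I| ->
  exists J, [/\ I \subset J, J \subset X, rk M J = #|J| & #|J| = rk M X].
Proof.
move=> IX rkI.
pose P J := [&& I \subset J, J \subset X & rk M J == #|J|].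
have [|J /maxsetP[/and3P[IJ JX /eqP rkJ] maxJ]] := @ex_maxset _ P.
  by exists I; rewrite /P subxx IX rkI eqxx.
exists J; split=> //; rewrite -rkJ -(setUidPr JX); apply/esym/rk_setU_eq => e eX.
have [eJ|eJ] := boolP (e \in J); first by rewrite (setUidPr _) // sub1set.
have := rk_mono M (subsetUr [set e] J).
have := rk_setU_card J [set e]; rewrite cards1 [J :|: _]setUC => leS geJ.
have [//|neq] := eqVneq (rk M (e |: J)) (rk M J).
suff eqJ : e |: J = J by rewrite -eqJ setU11 in eJ.
apply: maxJ; last exact: subsetUr.
rewrite /P subsetU ?IJ ?orbT // subUset sub1set eX JX /= cardsU1 eJ.
by apply/eqP; lia.
Qed.

(** Some [j] in [S] is independent of [B :&: S]. Extending [j |: B :&: S] to a basis inside [j |: B]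
    omits a single element, and it lies outside [S] because all of [B :&: S] was kept. *)
Lemma basis_exchange S B : is_basis M B -> #|B :&: S| < rk M S ->
  exists i j, [/\ i \in B, i \notin S, j \notin B, j \in S &
    is_basis M (j |: B :\ i)].
Proof.
move=> /andP[/eqP rkB /eqP cB] ltS.
have rkBS : rk M (B :&: S) = #|B :&: S| by apply: indep_subset rkB; apply: subsetIl.
have [j jS rkj] : exists2 j, j \in S & rk M (j |: B :&: S) != rk M (B :&: S).
  apply/exists_inP; apply: contraLR ltS => /exists_inPn spanS; rewrite -leqNgt.
  rewrite -rkBS -(@rk_setU_eq (B :&: S) S) ?rk_mono ?subsetUr // => e eS.
  by apply/eqP/negPn/spanS.
have jBS : j \notin B :&: S.
  by apply: contraNN rkj => jBS; rewrite (setUidPr _) // sub1set.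
have jB : j \notin B by move: jBS; rewrite inE jS andbT.
have [|| J [BSJ JB rkJ cJ]] := @indep_extend (j |: B :&: S) (j |: B).
- by apply/setUS/subsetIl.
- have := rk_setU_card (B :&: S) [set j]; rewrite setUC cards1 cardsU1 jBS -rkBS.
  by have := rk_mono M (subsetUr [set j] (B :&: S)); move/eqP: rkj; lia.
have cJd : #|J| = rank M.
  apply/eqP; rewrite cJ eqn_leq rk_mono ?subsetT //= -cB -rkB rk_mono //.
  exact: subsetUr.
have jJ : j \in J by apply: (subsetP BSJ); rewrite setU11.
have [i] : exists i, i \in (j |: B) :\: J.
  apply/card_gt0P; rewrite cardsD (setIidPr JB) cardsU1 jB cJd cB; lia.
rewrite !inE => /andP[iJ /predU1P[eqij|iB]]; first by rewrite eqij jJ in iJ.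
exists i, j; split=> //.
  by apply: contraNN iJ => iS; apply: (subsetP BSJ); rewrite !inE iB iS orbT.
suff <- : J = j |: B :\ i by rewrite /is_basis rkJ cJd eqxx.
apply/eqP; rewrite eqEcard; apply/andP; split.
  apply/subsetP => x xJ; have := subsetP JB x xJ; rewrite !inE.
  by case: eqP => //= _ ->; rewrite andbT; apply: contraNneq iJ => <-.
rewrite cJd -cB cardsU1 !inE negb_and jB orbT (cardsD1 i B) iB; lia.
Qed.

(** [separator] quantifies over all [X]; modularity of one pair over the ground set restricts to
    each of them. *)
Lemma connected_matroid_between : connected_matroid M ->
  connected_between (rk M) set0 setT.
Proof.
move=> conM S U SU0 SUT modSU.
have [S0|S0] := eqVneq S set0; [by left | have [ST|ST] := eqVneq S setT].
  by right; setdec.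
case: (conM _ S0 ST) => X.
have [] := modular_restrict (rk_submod M) (sub0set X) (subsetT X) SU0 SUT modSU.
rewrite rk_set0 add0n => <- _; rewrite setIC; congr (_ + rk M _).
by setdec.
Qed.

(** A separation of [A] over [X] has [G] wholly on one side. As [B] meets [A] exactly in [G], it can
    be added to that side, and the result separates [Y]. *)
Lemma connected_between_summand X Y G A B : X \subset G -> G != X ->
  A :&: B = G -> A :|: B = Y -> rk M A + rk M B = rk M G + rk M Y ->
  connected_between (rk M) X Y -> connected_between (rk M) X G ->
  connected_between (rk M) X A.
Proof.
move=> XG neGX AB_G AB_Y modAB conXY conXG.
have absurd P Q : P :&: Q = X -> P :|: Q = A ->
    rk M P + rk M Q = rk M X + rk M A -> P :&: G = X -> P = X \/ Q = X.
  move=> PQ_X PQ_A modPQ PG_X; have QB : Q :&: B = G by setdec.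
  have PQB_Y : P :|: (Q :|: B) = Y by setdec.
  have PQB_X : P :&: (Q :|: B) = X by setdec.
  have [|->|eqX] := conXY P (Q :|: B) PQB_X PQB_Y; [|by left|].
    have := rk_submod M P (Q :|: B); have := rk_submod M Q B.
    by rewrite QB PQB_Y PQB_X; lia.
  by case/eqP: neGX; setdec.
move=> P Q PQ_X PQ_A modPQ; have GA : G \subset A by setdec.
have [modI _] := modular_restrict (rk_submod M) XG GA PQ_X PQ_A modPQ.
have [||eqX|eqX] := conXG (P :&: G) (Q :&: G) _ _ modI; [setdec | setdec | |].
  exact: absurd.
have QP : Q = X \/ P = X.
  by apply: absurd; [rewrite setIC | rewrite setUC | rewrite addnC | exact: eqX].
by case: QP; [right | left].
Qed.

(** A minimal dependent set over [X] is a circuit of the contraction by [X]. A separation would cut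
    it into two independent parts, whose ranks would add up to its full size. *)
Lemma connected_between_circuit X S : X \subset S ->
  rk M S < rk M X + #|S :\: X| ->
  exists C, [/\ X \subset C, C \subset S, connected_between (rk M) X C &
    rk M C < rk M X + #|C :\: X|].
Proof.
move=> XS depS; pose dep A := [&& X \subset A, A \subset S & rk M A < rk M X + #|A :\: X|].
have [|C /minsetP[/and3P[XC CS depC] minC]] := @ex_minset _ dep.
  by exists S; rewrite /dep XS subxx depS.
exists C; split=> // A B AB_X AB_C modAB.
have indep A' : X \subset A' -> A' \subset C -> A' != C ->
    rk M A' = rk M X + #|A' :\: X|.
  move=> XA' A'C neqA'; have := rk_subset_card XA'.
  have [depA'|] := ltnP (rk M A') (rk M X + #|A' :\: X|); last by lia.
  case/eqP: neqA'; apply: minC => //.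
  by rewrite /dep XA' (subset_trans A'C CS) depA'.
have [eqA|neqA] := eqVneq A C; first by right; setdec.
have [eqB|neqB] := eqVneq B C; first by left; setdec.
have XA : X \subset A by setdec.
have XB : X \subset B by setdec.
have AC : A \subset C by setdec.
have BC : B \subset C by setdec.
have := cardsUI (A :\: X) (B :\: X).
have -> : (A :\: X) :|: (B :\: X) = C :\: X by setdec.
have -> : (A :\: X) :&: (B :\: X) = set0 by setdec.
by rewrite cards0; move: modAB; rewrite (indep A) // (indep B) //; lia.
Qed.

(** The strict rank bounds are as important as connectedness: they later give every block of the
    chain an average coordinate strictly between 0 and 1. *)
Lemma connected_nonuniform_split X Y S : X \subset S -> S \subset Y ->
  connected_between (rk M) X Y -> rk M S < rk M Y -> rk M S < rk M X + #|S :\: X| ->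
  exists G, [/\ X \subset G /\ G \subset Y,
    connected_between (rk M) X G, connected_between (rk M) G Y,
    rk M X < rk M G < rk M X + #|G :\: X| &
    rk M G < rk M Y < rk M G + #|Y :\: G|].
Proof.
move=> XS SY conXY ltSY depS.
have [C [XC CS conXC depC]] := connected_between_circuit XS depS.
(* A maximal connected restriction of smaller rank has a connected quotient:
   a proper modular pair of the quotient would enlarge it. *)
pose good A := `[< [/\ X \subset A, A \subset Y, connected_between (rk M) X A,
  rk M A < rk M Y & rk M A < rk M X + #|A :\: X|] >].
have goodC : good C.
  apply/asboolP; split=> //; first exact: subset_trans SY.
  exact: leq_ltn_trans (rk_mono M CS) ltSY.
have [G /maxsetP[/asboolP[XG GY conXG ltGY depG] maxG] _] := maxset_exists goodC.
have neGX : G != X by apply: contraTneq depG => ->; rewrite setDv cards0; lia.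
clear C XC CS conXC depC goodC S XS SY ltSY depS.
have conGY : connected_between (rk M) G Y.
  move=> A B AB_G AB_Y modAB.
  have notlt A' B' : A' :&: B' = G -> A' :|: B' = Y ->
      rk M A' + rk M B' = rk M G + rk M Y -> rk M A' < rk M Y -> A' = G.
    move=> AB_G' AB_Y' modAB' ltA'; have GA' : G \subset A' by rewrite -AB_G' subsetIl.
    apply: maxG => //; apply/asboolP; split=> //.
    - exact: subset_trans GA'.
    - by rewrite -AB_Y' subsetUl.
    - exact: connected_between_summand modAB' _ _.
    have := rk_subset_card GA'; have := cardsID G (A' :\: X).
    have -> : (A' :\: X) :&: G = G :\: X by clear -GA'; setdec.
    have -> : (A' :\: X) :\: G = A' :\: G by clear -XG; setdec.
    by lia.
  have [ltA|ltB] : rk M A < rk M Y \/ rk M B < rk M Y by lia.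
    by left; apply: notlt modAB ltA.
  by right; apply: (notlt B A) => //; [rewrite setIC | rewrite setUC | rewrite addnC].
have XY : X \subset Y := subset_trans XG GY.
have neGY : G != Y by apply: contraTneq ltGY => ->; rewrite ltnn.
(* If G or its relative complement had full rank in its interval, then G and
   X :|: (Y :\: G) would be a proper modular pair. *)
have eqI : G :&: (X :|: (Y :\: G)) = X by clear -XG; setdec.
have eqU : G :|: (X :|: (Y :\: G)) = Y by clear -XG GY; setdec.
have nmodG : rk M G + rk M (X :|: (Y :\: G)) <> rk M X + rk M Y.
  move=> modG; have [eqG|eqY] := conXY _ _ eqI eqU modG; first by case/eqP: neGX.
  by case/eqP: neGY; rewrite -eqU eqY (setUidPl XG).
have := rk_submod M G (X :|: (Y :\: G)); have := rk_setU_card X (Y :\: G).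
have : rk M (X :|: (Y :\: G)) <= rk M Y by rewrite rk_mono // -{2}eqU subsetUr.
rewrite eqI eqU; have := rk_mono M XG.
by move=> le1 le2 le3; exists G; split=> //; apply/andP; split=> //; lia.
Qed.

(** An element outside [G] that does not raise its rank is a loop over [G] and splits off alone; the
    rank bound excludes that it is the whole rest. *)
Lemma flat_connected_between G : connected_between (rk M) G setT ->
  rk M G < rank M -> flat M G.
Proof.
rewrite /rank => conGT ltG; apply/forallP => e; apply/implyP => eG.
rewrite ltnNge; apply/negP => leG.
have eqI : (e |: G) :&: (setT :\ e) = G.
  by apply/setP => x; rewrite !inE; have [->|] := eqVneq x e; rewrite ?(negPf eG) ?andbT.
have eqU : (e |: G) :|: (setT :\ e) = setT.
  by apply/setP => x; rewrite !inE; case: eqP => // _; rewrite orbT.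
have := rk_submod M (e |: G) (setT :\ e); rewrite eqI eqU => sub.
have leT := rk_mono M (subsetT (setT :\ e)).
have leeG := rk_mono M (subsetUr [set e] G).
have [|eqG|eqG] := conGT _ _ eqI eqU; [lia | |].
  by move: eG; rewrite -eqG setU11.
by move: sub; rewrite eqG; lia.
Qed.

Lemma exists_card_between A B k : A \subset B -> #|A| <= k <= #|B| ->
  exists S, [/\ A \subset S, S \subset B & #|S| = k].
Proof.
move=> AB /andP[]; elim: k => [|k IH].
  by rewrite leqn0 => /eqP A0 _; exists A; rewrite A0.
rewrite leq_eqVlt => /predU1P[cA _|]; first by exists A.
rewrite ltnS => /IH{}IH ltk; have [S [AS SB cS]] := IH (ltnW ltk).
have [x] : exists x, x \in B :\: S.
  by apply/card_gt0P; rewrite cardsD (setIidPr SB); lia.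
rewrite inE => /andP[xS xB]; exists (x |: S); rewrite cardsU1 xS cS; split=> //.
  by rewrite subsetU // AS orbT.
by rewrite subUset sub1set xB.
Qed.

(* Uniformity of the minor M | Y / X. *)
Definition uniform_between X Y : Prop :=
  forall S, X \subset S -> S \subset Y -> rk M S < rk M Y ->
    rk M S = rk M X + #|S :\: X|.

Lemma uniform_betweenP X Y : X \subset Y ->
  (forall S, X \subset S -> S \subset Y -> #|S :\: X| = rk M Y - rk M X ->
     rk M S = rk M Y) <-> uniform_between X Y.
Proof.
move=> XY; split=> [bases S XS SY ltS|unif S XS SY cS]; last first.
  have := rk_mono M SY; rewrite leq_eqVlt => /orP[/eqP//|ltS].
  by have := rk_mono M XY; have := unif S XS SY ltS; rewrite cS; lia.
have leX := rk_mono M XY.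
have basis B : B \subset Y :\: X -> #|B| = rk M Y - rk M X -> rk M (X :|: B) = rk M Y.
  move=> BYX cB; apply: bases; first exact: subsetUl.
    by rewrite subUset XY (subset_trans BYX (subsetDl _ _)).
  by rewrite -cB; congr #|pred_of_set _|; setdec.
have SXY : S :\: X \subset Y :\: X by exact: setSD.
(* A large [S] contains a basis of the minor, contradicting [ltS]; a small one extends to a basis
   and is therefore independent over [X]. *)
have [cS|cS] := leqP (rk M Y - rk M X) #|S :\: X|.
  have [|B [_ BSX cB]] := @exists_card_between set0 (S :\: X) (rk M Y - rk M X) (sub0set _).
    by rewrite cards0 cS.
  have : rk M (X :|: B) <= rk M S by apply: rk_mono; setdec.
  by rewrite basis // ?(subset_trans BSX); lia.
have [|B [SB BYX cB]] := @exists_card_between (S :\: X) (Y :\: X) (rk M Y - rk M X) SXY.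
  by rewrite (ltnW cS) leq_subLR rk_subset_card.
have := rk_setU_card S (B :\: S).
have -> : S :|: B :\: S = X :|: B by setdec.
have := rk_subset_card XS; have := cardsID S B.
have -> : B :&: S = S :\: X by setdec.
by rewrite basis // cB; lia.
Qed.

Lemma uniform_restrictionE F :
  uniform_matroid (restriction M F) <-> uniform_between set0 F.
Proof.
have rkT : rank (restriction M F) = rk M F.
  rewrite /rank /= /rk_restriction; congr (rk M _); apply/setP => x.
  apply/imsetP/idP => [[y _ ->]|xF]; first exact: valP.
  by exists (Sub x xF).
rewrite -uniform_betweenP ?sub0set // rk_set0 subn0.
split=> [unif S _ SF|bases B cB].
  rewrite setD0 => cS; pose B := [set x : {x | x \in F} | val x \in S].
  have eqS : [set val x | x in B] = S.
    apply/setP => x; apply/imsetP/idP => [[y]|xS]; first by rewrite inE => ? ->.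
    by exists (Sub x (subsetP SF x xS)); rewrite ?inE.
  have /unif/andP[/eqP] : #|B| = rank (restriction M F).
    by rewrite rkT -cS -eqS card_imset //; apply: val_inj.
  by rewrite /= /rk_restriction eqS => -> /eqP->.
rewrite /is_basis cB eqxx andbT rkT /= /rk_restriction; apply/eqP/bases.
- exact: sub0set.
- by apply/subsetP => _ /imsetP[x _ ->]; apply: valP.
by rewrite setD0 card_imset ?cB //; apply: val_inj.
Qed.

Lemma uniform_contractionE F :
  uniform_matroid (contraction M F) <-> uniform_between F setT.
Proof.
have rkT : rank (contraction M F) = rank M - rk M F.
  rewrite /rank /= /rk_contraction; congr (rk M _ - _); apply/setP => x.
  rewrite !inE; apply/orP; have [xF|xF] := boolP (x \in F); first by right.
  by left; apply/imsetP; exists (Sub x xF).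
have imF (B : {set {x | x \notin F}}) :
    ([set val x | x in B] :|: F) :\: F = [set val x | x in B].
  rewrite setDUl setDv setU0; apply/setP=> y; rewrite inE andb_idl //.
  by move=> /imsetP[x _ ->]; apply: (valP x).
rewrite -uniform_betweenP ?subsetT //; split=> [unif S FS _ cS|bases B cB].
  pose B : {set {x | x \notin F}} := [set x | val x \in S].
  have eqS : [set val x | x in B] :|: F = S.
    apply/setP => x; rewrite inE; apply/orP/idP => [[/imsetP[y]|]|xS].
    - by rewrite inE => ? ->.
    - exact: subsetP.
    have [xF|xF] := boolP (x \in F); [by right | left].
    by apply/imsetP; exists (Sub x xF); rewrite ?inE.
  have /unif/andP[/eqP rkB /eqP cB] : #|B| = rank (contraction M F).
    by rewrite rkT /rank -cS -eqS imF card_imset //; apply: val_inj.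
  have : rk_contraction M B = #|B| by exact: rkB.
  rewrite cB rkT /rk_contraction eqS /rank.
  have := rk_mono M FS; have := rk_mono M (subsetT S).
  by have := rk_mono M (subsetT F); lia.
rewrite /is_basis cB eqxx andbT rkT /= /rk_contraction /rank; apply/eqP.
by rewrite bases ?subsetT ?subsetUr // imF card_imset ?cB //; apply: val_inj.
Qed.

Lemma uniform_betweenPn X Y : ~ uniform_between X Y ->
  exists S, [/\ X \subset S, S \subset Y, rk M S < rk M Y &
    rk M S < rk M X + #|S :\: X|].
Proof.
move=> nunif; apply: contrapT => nex; apply: nunif => S XS SY ltS.
have := rk_subset_card XS; rewrite leq_eqVlt => /orP[/eqP//|dep].
by case: nex; exists S.
Qed.

End MatroidTheory.

(** * Bases on a face and functionals constant on them *)

Section FaceBases.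
Variables (T : finType) (M : matroid T).
Implicit Types A B S U G : {set T}.

(* The bases spanning the face of the matroid polytope on which the G-th rank
   inequality is tight. *)
Definition face_basis G B : bool := is_basis M B && (#|B :&: G| == rk M G).

Lemma basis_card B : is_basis M B -> #|B| = rank M.
Proof. by case/andP => _ /eqP. Qed.

Lemma basis_cardI G B : is_basis M B -> #|B :&: G| <= rk M G.
Proof.
case/andP => /eqP rkB _; rewrite -(indep_subset (subsetIl B G) rkB).
exact/rk_mono/subsetIr.
Qed.

Lemma face_basis_exists G : exists B, face_basis G B.
Proof.
have [|J [_ JG rkJ cJ]] := @indep_extend _ M set0 G (sub0set G).
  by rewrite rk_set0 cards0.
have [B [JB _ rkB cB]] := indep_extend (subsetT J) rkJ.
have basisB : is_basis M B by rewrite /is_basis rkB cB eqxx.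
exists B; rewrite /face_basis basisB eqn_leq basis_cardI // -cJ subset_leq_card //.
by rewrite subsetI JB JG.
Qed.

(** Since [S] and [G] are comparable, the exchange cannot decrease [#|B :&: G|], and this number is
    already maximal; so [i] and [j] lie on the same side of [G]. *)
Lemma face_basis_exchange G S B : face_basis G B -> S \subset G \/ G \subset S ->
  #|B :&: S| < rk M S ->
  exists i j, [/\ i \in B, i \notin S, j \notin B, j \in S & (i \in G) = (j \in G)] /\
    face_basis G (j |: B :\ i).
Proof.
case/andP=> basisB /eqP cBG chain ltS.
have [i [j [iB iS jB jS basisB']]] := basis_exchange basisB ltS.
have neij : i != j by apply: contraNneq jB => <-.
have cB' : #|(j |: B :\ i) :&: G| + (i \in G) = #|B :&: G| + (j \in G).
  rewrite setIUl (cardsD1 i (B :&: G)) inE iB /=.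
  have -> : (B :\ i) :&: G = (B :&: G) :\ i by rewrite setIDAC.
  have [jG|jG] := boolP (j \in G).
    have jBG : j \notin (B :&: G) :\ i by rewrite !inE (negPf jB) andbF.
    by rewrite (setIidPl _) ?sub1set // cardsU1 jBG add1n addSn addn1 addnC.
  suff -> : [set j] :&: G = set0 by rewrite set0U addn0 addnC.
  by apply/setP => x; rewrite !inE; case: eqP => // ->; apply/negbTE.
have leG := basis_cardI G basisB'.
have ijG : (i \in G) = (j \in G).
  case: chain => [/subsetP SG|/subsetP GS].
    by rewrite (SG j jS) in cB' *; case: (i \in G) cB' => //; lia.
  have iG : i \notin G by apply: contraNN iS; apply: GS.
  by rewrite (negPf iG) in cB' *; case: (j \in G) cB' => //; lia.
exists i, j; split=> //; rewrite /face_basis basisB' /=.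
by move: cB'; rewrite ijG => /addIn ->; apply/eqP.
Qed.

(** This is the dimension count for facets: functionals constant on the face come from the
    indicators of [G] and its complement. Were a level set of [c] (within one side of [G]) not tight
    for [B], an exchange would swap elements with different values and change the sum. So a level
    set and its relative complement are both tight, hence a modular pair, and connectedness makes it
    trivial. *)
Lemma face_basis_functional (V : zmodType) (c : T -> V) G :
  connected_between (rk M) set0 G -> connected_between (rk M) G setT ->
  (forall B B', face_basis G B -> face_basis G B' ->
     (\sum_(i in B) c i = \sum_(i in B') c i)%R) ->
  forall x y, (x \in G) = (y \in G) -> c x = c y.
Proof.
move=> con0G conGT cst x y xyG.
have [B faceB] := face_basis_exists G.
have [basisB /eqP cBG] := andP faceB.
have exch i j : i \in B -> j \notin B -> face_basis G (j |: B :\ i) -> c i = c j.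
  move=> iB jB faceB'; have := cst _ _ faceB faceB'.
  rewrite (big_setD1 i iB) /= big_setU1 ?inE ?negb_and ?jB ?orbT //=.
  exact: addIr.
have tight S : S \subset G \/ G \subset S ->
    (forall i j, i \notin S -> j \in S -> (i \in G) = (j \in G) -> c i <> c j) ->
    #|B :&: S| = rk M S.
  move=> chain neq; apply/eqP; rewrite eqn_leq basis_cardI // leqNgt.
  apply/negP => /(face_basis_exchange faceB chain)[i [j [[iB iS jB jS ijG] faceB']]].
  exact: neq iS jS ijG (exch _ _ iB jB faceB').
have [xG|xG] := boolP (x \in G).
  pose S := [set z in G | c z == c x]; pose U := [set z in G | c z != c x].
  have cS : #|B :&: S| = rk M S.
    apply: tight => [|i j]; first by left; apply/subsetP => z; rewrite inE => /andP[].
    rewrite !inE negb_and => /orP[/negPf->|/eqP neq] /andP[-> /eqP->] // _ eqc.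
  have cU : #|B :&: U| = rk M U.
    apply: tight => [|i j]; first by left; apply/subsetP => z; rewrite inE => /andP[].
    rewrite !inE negb_and => /orP[/negPf->|/negPn/eqP->] /andP[-> /eqP neq] // _ eqc.
    by apply: neq.
  have SU0 : S :&: U = set0.
    by apply/setP => z; rewrite !inE; case: (c z == c x); rewrite ?andbF.
  have SUG : S :|: U = G.
    by apply/setP => z; rewrite !inE; case: (c z == c x); rewrite ?andbF ?andbT ?orbF.
  have [|eqS|eqU] := con0G S U SU0 SUG.
  - rewrite rk_set0 -cS -cU -cBG -cardsUI -setIUr SUG addnC -setIIr SU0.
    by rewrite setI0 cards0.
  - by have := in_set0 x; rewrite -eqS !inE xG eqxx.
  have := in_set0 y; rewrite -eqU !inE -xyG xG /=.
  by move/negbFE/eqP.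
pose S := G :|: [set z | c z == c x]; pose U := G :|: [set z | c z != c x].
have yG : y \notin G by rewrite -xyG.
have cS : #|B :&: S| = rk M S.
  apply: tight => [|i j]; first by right; apply: subsetUl.
  rewrite !inE negb_or => /andP[/negPf-> /eqP neq] /orP[-> //|/eqP->] _.
  by move/neq.
have cU : #|B :&: U| = rk M U.
  apply: tight => [|i j]; first by right; apply: subsetUl.
  rewrite !inE negb_or => /andP[/negPf-> /negPn/eqP->] /orP[-> //|/eqP neq] _.
  by move/esym/neq.
have SUG : S :&: U = G.
  by apply/setP => z; rewrite !inE; case: (z \in G) => //=; case: eqP.
have SUT : S :|: U = setT.
  by apply/setP => z; rewrite !inE; case: (z \in G) => //=; case: eqP.
have [|eqS|eqU] := conGT S U SUG SUT.
- rewrite -cS -cU -cBG -/(rank M) -(basis_card basisB) -cardsUI -setIUr SUT.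
  by rewrite -setIIr SUG setIT addnC.
- by move/setP/(_ x): eqS; rewrite !inE eqxx orbT (negPf xG).
by move/setP/(_ y): eqU; rewrite !inE (negPf yG) /= => /negbFE/eqP.
Qed.

End FaceBases.

(** * Convex hulls and 0/1 polytopes *)

Local Open Scope ring_scope.

Section Hulls.
Variables (R : realType) (n : nat).
Local Notation V := 'rV[R]_n.
Implicit Types (P Q : set V) (x y z c v : V).

Definition dot c x : R := \sum_i c 0 i * x 0 i.

Lemma dotDr c x y : dot c (x + y) = dot c x + dot c y.
Proof. by rewrite /dot -big_split; apply: eq_bigr => i _; rewrite mxE mulrDr. Qed.

Lemma dotZr c a x : dot c (a *: x) = a * dot c x.
Proof. by rewrite /dot mulr_sumr; apply: eq_bigr => i _; rewrite mxE mulrCA. Qed.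

Lemma dotDl c c' x : dot (c + c') x = dot c x + dot c' x.
Proof. by rewrite /dot -big_split; apply: eq_bigr => i _; rewrite mxE mulrDl. Qed.

Lemma dotZl a c x : dot (a *: c) x = a * dot c x.
Proof. by rewrite /dot mulr_sumr; apply: eq_bigr => i _; rewrite mxE mulrA. Qed.

Lemma dot_comb c k (w : 'I_k -> R) (p : 'I_k -> V) :
  dot c (\sum_i w i *: p i) = \sum_i w i * dot c (p i).
Proof.
under [RHS]eq_bigr => i _ do rewrite /dot mulr_sumr.
rewrite exchange_big /=; apply: eq_bigr => j _; rewrite summxE mulr_sumr.
by apply: eq_bigr => i _; rewrite mxE mulrCA.
Qed.

Lemma dot_char_vec (A : {set 'I_n}) x : dot (char_vec R A) x = \sum_(i in A) x 0 i.
Proof.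
rewrite /dot [RHS]big_mkcond; apply: eq_bigr => i _; rewrite mxE.
by case: (i \in A); rewrite ?mul1r ?mul0r.
Qed.

Lemma dot_char_vecr (B : {set 'I_n}) c : dot c (char_vec R B) = \sum_(i in B) c 0 i.
Proof.
rewrite /dot [RHS]big_mkcond; apply: eq_bigr => i _; rewrite mxE.
by case: (i \in B); rewrite ?mulr1 ?mulr0.
Qed.

Lemma sum_char_vec (A B : {set 'I_n}) :
  \sum_(i in A) char_vec R B 0 i = #|(B :&: A)%SET|%:R.
Proof.
rewrite (eq_bigr (fun i => (i \in B)%:R)) => [|i _]; last by rewrite mxE.
rewrite -natr_sum -sum1_card big_mkcond [in RHS]big_mkcond /=.
by congr _%:R; apply: eq_bigr => i _; rewrite inE andbC; case: (i \in A); case: (i \in B).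
Qed.

Lemma sub_convex_hull P : (P `<=` convex_hull P)%classic.
Proof.
move=> x Px; exists 1%N, (fun=> x), (fun=> 1); split=> //; first by rewrite big_ord1.
by rewrite big_ord1 scale1r.
Qed.

Lemma convex_hullP P x y (a b : R) : convex_hull P x -> convex_hull P y ->
  0 <= a -> 0 <= b -> a + b = 1 -> convex_hull P (a *: x + b *: y).
Proof.
move=> [k [p [w [Pp w0 w1 ->]]]] [l [q [u [Pq u0 u1 ->]]]] a0 b0 ab1.
exists (k + l)%N, (fun i => match split i with inl i => p i | inr j => q j end).
exists (fun i => match split i with inl i => a * w i | inr j => b * u j end).
have sl (i : 'I_k) : split (lshift l i) = inl i.
  by rewrite -[lshift _ _]/(unsplit (inl i)) unsplitK.
have sr (i : 'I_l) : split (rshift k i) = inr i.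
  by rewrite -[rshift _ _]/(unsplit (inr i)) unsplitK.
split.
- by move=> i; case: split.
- by move=> i; case: split => j; apply: mulr_ge0.
- rewrite big_split_ord /= (eq_bigr (fun i => a * w i)) => [|i _]; last by rewrite sl.
  rewrite [X in _ + X](eq_bigr (fun i => b * u i)) => [|i _]; last by rewrite sr.
  by rewrite -!mulr_sumr w1 u1 !mulr1.
rewrite big_split_ord /= !scaler_sumr; congr (_ + _); apply: eq_bigr => i _.
  by rewrite sl scalerA.
by rewrite sr scalerA.
Qed.

Lemma convex_hull_sum P k (p : 'I_k -> V) (w : 'I_k -> R) :
  (forall i, convex_hull P (p i)) -> (forall i, 0 <= w i) -> \sum_i w i = 1 ->
  convex_hull P (\sum_i w i *: p i).
Proof.
elim: k p w => [|k IH] p w Pp w0; first by rewrite big_ord0 => /esym/eqP; rewrite oner_eq0.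
rewrite !big_ord_recl => w1; have [w00|w00] := eqVneq (w ord0) 1.
  move: w1; rewrite w00 -[RHS]addr0 => /addrI/eqP; rewrite psumr_eq0 // => /allP w'0.
  rewrite big1 ?addr0 ?scale1r // => i _.
  by have /eqP-> := w'0 i (mem_index_enum _); rewrite scale0r.
have s_gt0 : 0 < 1 - w ord0.
  rewrite subr_gt0 lt_neqAle w00 -w1 lerDl sumr_ge0 //.
have -> : \sum_(i < k) w (lift ord0 i) *: p (lift ord0 i) = 
    (1 - w ord0) *: \sum_(i < k) (w (lift ord0 i) / (1 - w ord0)) *: p (lift ord0 i).
  rewrite scaler_sumr; apply: eq_bigr => i _.
  by rewrite scalerA mulrCA divff ?mulr1 ?gt_eqF.
apply: convex_hullP => //; [| exact: ltW | by rewrite addrC subrK].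
apply: IH => // [i|]; first by rewrite divr_ge0 // ltW.
have eqs : \sum_(i < k) w (lift ord0 i) = 1 - w ord0 by rewrite -w1 addrC addKr.
by rewrite -mulr_suml eqs divff // gt_eqF.
Qed.

Lemma convex_hull_le P c (b : R) : (forall p, P p -> dot c p <= b) ->
  forall x, convex_hull P x -> dot c x <= b.
Proof.
move=> leb _ [k [p [w [Pp w0 w1 ->]]]]; rewrite dot_comb -[b]mul1r -w1 mulr_suml.
by apply: ler_sum => i _; rewrite ler_wpM2l // leb.
Qed.

Lemma convex_hull_face P c (b : R) : (forall p, P p -> dot c p <= b) ->
  (convex_hull P `&` [set x | dot c x = b] =
   convex_hull (P `&` [set x | dot c x = b]))%classic.
Proof.
move=> leb; apply/seteqP; split=> [x [[k [p [w [Pp w0 w1 eqx]]]] /= xb]|x].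
  have [i0 wi0] : exists i0, w i0 != 0.
    apply/existsP; apply: contraPT (oner_neq0 R) => /existsPn w_eq0.
    by rewrite -w1 big1 ?eqxx // => i _; have := w_eq0 i; rewrite negbK => /eqP.
  have tight i : w i != 0 -> dot c (p i) = b.
    move=> wi; have : \sum_i w i * (b - dot c (p i)) = 0.
      under eq_bigr do rewrite mulrBr.
      by rewrite sumrB -mulr_suml w1 mul1r -dot_comb -eqx xb subrr.
    move=> /eqP; rewrite psumr_eq0 => [/allP/(_ i (mem_index_enum _))|j _].
      by rewrite mulf_eq0 (negPf wi) subr_eq0 => /eqP.
    by rewrite mulr_ge0 ?subr_ge0 ?leb.
  (* Generators of weight zero may lie off the face; they are replaced by one that lies on it. *)
  exists k, (fun i => if w i == 0 then p i0 else p i), w; split=> //.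
    by move=> i; case: ifPn => [_|wi]; split=> //; apply: tight.
  rewrite eqx; apply: eq_bigr => i _; case: eqP => // ->.
  by rewrite !scale0r.
move=> [k [p [w [Pp w0 w1 ->]]]]; split.
  by exists k, p, w; split=> // i; case: (Pp i).
rewrite /= dot_comb (eq_bigr (fun i => w i * b)) => [|i _].
  by rewrite -mulr_suml w1 mul1r.
by case: (Pp i) => _ ->.
Qed.

End Hulls.

(** * Integrality of a hypersimplex cut at an integer level *)

Section Integrality.
Variables (R : realType) (n : nat).
Local Notation V := 'rV[R]_n.
Implicit Types (x y z : V) (A B S : {set 'I_n}) (i j : 'I_n).

Definition half_hypersimplex (d : nat) A (r : nat) : set V :=
  (@hypersimplex R n d `&` [set x | \sum_(i in A) x 0 i <= r%:R])%classic.

Definition fractional x : {set 'I_n} := [set i | (x 0 i != 0) && (x 0 i != 1)].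

Lemma sumT (f : 'I_n -> R) : \sum_i f i = \sum_(i in [set: 'I_n]) f i.
Proof. by apply: eq_bigl => i; rewrite in_setT. Qed.

Lemma fractionalP x i : unit_cube x -> (i \in fractional x) = (0 < x 0 i < 1).
Proof. by move=> /(_ i)/andP[x0 x1]; rewrite inE !lt_neqAle x0 x1 !andbT eq_sym. Qed.

Lemma sum_fractional x S : unit_cube x ->
  \sum_(i in S) x 0 i =
    #|[set i in S | x 0 i == 1]|%:R + \sum_(i in fractional x :&: S) x 0 i.
Proof.
move=> xcube; rewrite (bigID (mem (fractional x))) /= addrC; congr (_ + _); last first.
  by apply: eq_bigl => i; rewrite in_setI andbC.
rewrite (eq_bigr (fun i => (x 0 i == 1)%:R)) => [|i /andP[_]]; last first.
  rewrite inE negb_and !negbK => /orP[]/eqP->; last by rewrite eqxx.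
  by rewrite eq_sym oner_eq0.
rewrite -natr_sum -sum1_card big_mkcond [in RHS]big_mkcond /=; congr _%:R.
apply: eq_bigr => i _; rewrite !inE negb_and !negbK.
by case: (i \in S) => //=; have [->|] := eqVneq (x 0 i) 1; rewrite ?orbT //; case: ifP.
Qed.

(* Moves weight from j to i until one of the two coordinates becomes 0 or 1. *)
Definition transfer x i j : V :=
  \row_k (x 0 k + Num.min (1 - x 0 i) (x 0 j) * ((k == i)%:R - (k == j)%:R)).

Lemma transfer_cube x i j : unit_cube x -> i != j -> unit_cube (transfer x i j).
Proof.
move=> xcube neij k; rewrite mxE.
have /andP[xk0 xk1] := xcube k; have /andP[xi0 xi1] := xcube i.
have /andP[xj0 xj1] := xcube j.
have [eqk|_] := eqVneq k i.
  by rewrite eqk (negPf neij) subr0 mulr1; have [?|?] := leP (1 - x 0 i) (x 0 j);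
    apply/andP; split; lra.
have [->|_] := eqVneq k j; last by rewrite subrr mulr0 addr0 xk0.
by rewrite sub0r mulrN1; have [?|?] := leP (1 - x 0 i) (x 0 j); apply/andP; split; lra.
Qed.

Lemma sum_transfer x i j S : \sum_(k in S) transfer x i j 0 k =
  \sum_(k in S) x 0 k + Num.min (1 - x 0 i) (x 0 j) * ((i \in S)%:R - (j \in S)%:R).
Proof.
under eq_bigr do rewrite mxE.
rewrite big_split /= -mulr_sumr sumrB; congr (_ + _ * (_ - _)).
- rewrite big_mkcond (bigD1 i) //= eqxx big1 ?addr0; first by case: (i \in S).
  by move=> k /negPf->; case: ifP.
rewrite big_mkcond (bigD1 j) //= eqxx big1 ?addr0; first by case: (j \in S).
by move=> k /negPf->; case: ifP.
Qed.

Lemma fractional_transfer x i j : unit_cube x -> i != j ->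
  i \in fractional x -> j \in fractional x ->
  (#|fractional (transfer x i j)| < #|fractional x|)%N.
Proof.
move=> xcube neij ix jx; apply: proper_card; apply/properP; split.
  apply/subsetP => k; rewrite [k \in fractional (transfer _ _ _)]inE mxE.
  have [->//|_] := eqVneq k i; have [->//|_] := eqVneq k j.
  by rewrite subrr mulr0 addr0 inE.
have [le|lt] := leP (1 - x 0 i) (x 0 j).
  exists i => //; rewrite inE mxE eqxx (negPf neij) (min_idPl le) /=.
  by rewrite subr0 mulr1 addrC subrK eqxx andbF.
exists j => //; rewrite inE mxE eqxx [j == i]eq_sym (negPf neij) (min_idPr (ltW lt)) /=.
by rewrite sub0r mulrN1 subrr eqxx.
Qed.

Lemma transfer_comb x i j : unit_cube x -> i != j ->
    i \in fractional x -> j \in fractional x ->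
  exists a b : R, [/\ 0 <= a, 0 <= b, a + b = 1 &
    x = a *: transfer x i j + b *: transfer x j i].
Proof.
move=> xcube neij; rewrite !fractionalP // => /andP[xi0 xi1] /andP[xj0 xj1].
pose s := Num.min (1 - x 0 i) (x 0 j); pose t := Num.min (1 - x 0 j) (x 0 i).
have s_gt0 : 0 < s by rewrite lt_min subr_gt0 xi1 xj0.
have t_gt0 : 0 < t by rewrite lt_min subr_gt0 xj1 xi0.
have st_neq0 : s + t != 0 by rewrite gt_eqF ?addr_gt0.
exists (t / (s + t)), (s / (s + t)); split.
- by rewrite divr_ge0 ?addr_ge0 ?ltW.
- by rewrite divr_ge0 ?addr_ge0 ?ltW.
- by rewrite -mulrDl addrC divff.
apply/rowP => k; rewrite !mxE -/s -/t.
by field.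
Qed.

(** A transfer between two fractional coordinates on the same side of [A] keeps both sums. If no
    such pair exists, there is exactly one fractional coordinate on each side; then the sum over [A]
    is not an integer, and the bound [r] leaves room up to the next one. *)
Lemma half_hypersimplex_transfer d A r x : half_hypersimplex d A r x ->
  fractional x != set0 ->
  exists i j, [/\ i != j, i \in fractional x, j \in fractional x,
    half_hypersimplex d A r (transfer x i j) &
    half_hypersimplex d A r (transfer x j i)].
Proof.
move=> [[xcube /= sumx] sumA] /set0Pn[i iF].
have transfer_in i' j' : i' != j' ->
    \sum_(k in A) transfer x i' j' 0 k <= r%:R ->
    half_hypersimplex d A r (transfer x i' j').
  move=> neij leA; split=> //; split; first exact: transfer_cube.
  by rewrite /= -sumx !sumT sum_transfer !in_setT subrr mulr0 addr0.
have same i' j' : i' != j' -> (i' \in A) = (j' \in A) ->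
    half_hypersimplex d A r (transfer x i' j').
  move=> neij eqA; apply: transfer_in => //.
  by rewrite sum_transfer eqA subrr mulr0 addr0.
(* A single fractional coordinate would put the total [d] strictly between two consecutive
   integers. *)
have [j /andP[jF neij]] : exists j, (j \in fractional x) && (i != j).
  apply/existsP; apply: contraT => /existsPn only_i.
  have eqF : fractional x :&: setT = [set i].
    apply/setP => j; rewrite setIT inE; have := only_i j.
    have [->|_] := eqVneq j i; first by rewrite iF.
    by rewrite andbT => /negPf.
  have := sum_fractional setT xcube; rewrite eqF big_set1.
  rewrite -sumT sumx.
  move: iF; rewrite fractionalP // => /andP[xi0 xi1] eqd.
  set m := #|_| in eqd.
  have : (m%:R < d%:R :> R) && (d%:R < m.+1%:R :> R).
    by rewrite eqd -natr1 ltrDl xi0 ltrD2l xi1.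
  by rewrite !ltr_nat ltnS => /andP[ltmd]; rewrite leqNgt ltmd.
have [eqA|neqA] := eqVneq (i \in A) (j \in A).
  by exists i, j; split=> //; apply: same; rewrite // eq_sym.
have [[k [l [kF lF nekl eqkl]]]|only_ij] := pselect (exists k l,
    [/\ k \in fractional x, l \in fractional x, k != l & (k \in A) = (l \in A)]).
  by exists k, l; split=> //; apply: same; rewrite // eq_sym.
wlog iA : i j iF jF neij neqA / i \in A.
  move=> wl; have [iA|iA] := boolP (i \in A); first exact: wl iF jF neij neqA iA.
  have jA : j \in A by move: neqA; rewrite (negPf iA); case: (j \in A).
  by apply: wl jF iF _ _ jA; rewrite eq_sym.
have jA : j \notin A by move: neqA; rewrite iA; case: (j \in A).
have eqFA : fractional x :&: A = [set i].
  apply/setP => k; rewrite !inE -andbA; apply/and3P/eqP => [[k0 k1 kA]|->].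
    apply: contrapT => neki; apply: only_ij; exists k, i; split=> //.
    - by rewrite inE k0.
    - exact/eqP.
    by rewrite kA.
  by move: iF; rewrite inE => /andP[].
have := sum_fractional A xcube; rewrite eqFA big_set1; set m := #|_| => eqsum.
move: (iF); rewrite fractionalP // => /andP[xi0 xi1].
have xj0 : 0 <= x 0 j by case/andP: (xcube j).
(* The sum over [A] exceeds [m] and is at most [r], so raising the coordinate [i] up to 1 still
   respects the bound. *)
have lem : m.+1%:R <= r%:R :> R.
  rewrite ler_nat -(ltr_nat R); apply: lt_le_trans sumA.
  by rewrite /= eqsum ltrDl.
have neji : j != i by rewrite eq_sym.
exists i, j; split=> //; apply: transfer_in; rewrite // sum_transfer iA (negPf jA).
  rewrite eqsum subr0 mulr1; apply: le_trans lem; rewrite -natr1 -addrA lerD2l.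
  by rewrite addrC -lerBrDr ge_min lexx.
rewrite sub0r mulrN1; apply: le_trans sumA; rewrite gerBl le_min subr_ge0.
by case/andP: (xcube j) => _ ->; rewrite ltW.
Qed.

Definition vertex_hull (K : {set {set 'I_n}}) : set V :=
  convex_hull [set char_vec R B | B in [set` K]]%classic.

Definition half_vertices d A r : {set {set 'I_n}} :=
  [set B : {set 'I_n} | (#|B| == d) && (#|B :&: A| <= r)%N].

(** By induction on the number of fractional coordinates, a point is a combination of its two
    opposite transfers. That all generators are 0/1 vectors is the reason why the split has no new
    vertices. *)
Lemma half_hypersimplex_hull d A r :
  half_hypersimplex d A r = vertex_hull (half_vertices d A r).
Proof.
have char01 B : unit_cube (char_vec R B).
  by move=> i; rewrite mxE; case: (i \in B); rewrite ?lexx ?ler01.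
apply/seteqP; split=> [x|x hx].
  move: {2}#|_|.+1 (ltnSn #|fractional x|) => m; elim: m x => // m IH x ltm hx.
  have [F0|F0] := eqVneq (fractional x) set0.
    apply: sub_convex_hull; pose B := [set i | x 0 i == 1].
    have eqx : x = char_vec R B.
      apply/rowP => i; rewrite mxE inE; have := in_set0 i; rewrite -F0 inE.
      have [->|_] := eqVneq (x 0 i) 1; first by [].  
      by rewrite andbT => /negbFE/eqP->.
    move: hx => [[_ /= sumx] /= sumA]; exists B => //=; rewrite inE.
    move: sumx; rewrite sumT eqx sum_char_vec setIT => /eqP; rewrite eqr_nat => ->.
    by move: sumA; rewrite eqx sum_char_vec ler_nat.
  have [i [j [neij iF jF hij hji]]] := half_hypersimplex_transfer hx F0.
  have xcube : unit_cube x by case: hx => [[]].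
  have [a [b [a0 b0 ab1 ->]]] := transfer_comb xcube neij iF jF.
  apply: convex_hullP => //; apply: IH => //; rewrite -ltnS;
    apply: leq_trans ltm; rewrite ltnS.
    exact: fractional_transfer.
  by apply: fractional_transfer; rewrite // eq_sym.
split; first split.
- move: hx => [k [p [w [Pp w0 w1 ->]]]] i; rewrite summxE; apply/andP; split.
    apply: sumr_ge0 => j _; rewrite mxE mulr_ge0 //.
    by case: (Pp j) => B _ <-; case/andP: (char01 B i).
  rewrite -w1; apply: ler_sum => j _; rewrite mxE -[leRHS]mulr1 ler_wpM2l //.
  by case: (Pp j) => B _ <-; case/andP: (char01 B i).
- move: hx => [k [p [w [Pp w0 w1 ->]]]] /=.
  rewrite sumT -dot_char_vec dot_comb -[RHS]mul1r -[X in X * _]w1 mulr_suml.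
  apply: eq_bigr => j _.
  congr (_ * _); case: (Pp j) => B; rewrite /= inE => /andP[/eqP<- _] <-.
  by rewrite dot_char_vec sum_char_vec setIT. 
rewrite /= -dot_char_vec; apply: (convex_hull_le _ hx) => p [B].
rewrite /= inE => /andP[_ leB] <-.
by rewrite dot_char_vec sum_char_vec ler_nat.
Qed.

End Integrality.

(** * Splits *)

Section Faces.
Variables (R : realType) (n : nat).
Local Notation V := 'rV[R]_n.
Implicit Types (P Q D : set V) (K : {set {set 'I_n}}).
Local Notation hull := (@vertex_hull R n).
Local Open Scope classical_set_scope.

Lemma face_refl P : face P P.
Proof.
have dot0 (x : V) : \sum_i (0 : V) 0 i * x 0 i = 0.
  by rewrite big1 // => i _; rewrite mxE mul0r.
exists 0, 0; split=> [x _|]; first by rewrite dot0.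
by apply/seteqP; split=> [x Px|x []//]; split=> //=; rewrite dot0.
Qed.

Lemma face_subset Q P : face Q P -> Q `<=` P.
Proof. by move=> [c [b [_ ->]]] x []. Qed.

Lemma face_setI Q Q' P : face Q P -> face Q' P -> face (Q `&` Q') P.
Proof.
move=> [c [b [leb eqQ]]] [c' [b' [leb' eqQ']]]; exists (c + c'), (b + b').
split=> [x Px|].
  by rewrite -/(dot _ _) dotDl lerD //; [apply: leb | apply: leb'].
rewrite {}eqQ {}eqQ'; apply/seteqP; split=> x /=; rewrite -!/(dot _ _) dotDl.
  by move=> [[Px ->] [_ ->]].
move=> [Px eqb]; have := leb x Px; have := leb' x Px; rewrite -!/(dot _ _).
by move=> le1 le2; split; split=> //; lra.
Qed.

Lemma face_sub Q Q' P : face Q P -> face Q' P -> Q' `<=` Q -> face Q' Q.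
Proof.
move=> faceQ [c [b [leb eqQ']]] subQ; exists c, b; split=> [x /(face_subset faceQ)/leb//|].
rewrite eqQ'; apply/seteqP; split=> x [Px xb]; split=> //.
  by apply: subQ; rewrite eqQ'.
exact: face_subset Px.
Qed.

Lemma vertex_hull_polytope K : polytope (hull K).
Proof.
exists [seq char_vec R B | B <- enum K]; congr convex_hull; apply/seteqP; split=> x /=.
  by move=> [B BK <-]; apply/mapP; exists B; rewrite ?mem_enum.
by move=> /mapP[B]; rewrite mem_enum => BK ->; exists B.
Qed.

Lemma vertex_hull_face K Q : face Q (hull K) ->
  exists2 K' : {set {set 'I_n}}, K' \subset K & Q = hull K'.
Proof.
move=> [c [b [leb eqQ]]]; exists [set B in K | dot c (char_vec R B) == b]%SET.
  by apply/subsetP => B; rewrite inE => /andP[].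
rewrite eqQ; apply: (etrans (@convex_hull_face _ _ _ c b _)) => [p Pp|].
  by apply: leb; apply: sub_convex_hull.
congr convex_hull; apply/seteqP; split=> x /=.
  by move=> [[B BK <-] /eqP eqb]; exists B => //; rewrite inE BK.
by move=> [B]; rewrite inE => /andP[BK /eqP eqb] <-; split=> //; exists B.
Qed.

(* The functional of a face of a face is perturbed by a large multiple of the
   functional of the face. *)
Lemma face_trans K Q Q' : face Q (hull K) -> face Q' Q ->
  face Q' (hull K).
Proof.
move=> [c [b [leb eqQ]]] [c' [b' [leb' eqQ']]].
pose s B := b - dot c (char_vec R B); pose s' B := dot c' (char_vec R B) - b'.
pose N := \sum_(B in K | s B != 0) `|s' B| / s B.
have s_ge0 B : B \in K -> 0 <= s B.
  by move=> BK; rewrite subr_ge0; apply: leb; apply: sub_convex_hull; exists B.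
have leN x : hull K x -> dot (N *: c + c') x <= N * b + b'.
  apply: convex_hull_le => _ [B /= BK <-]; rewrite dotDl dotZl.
  have [sB0|sB0] := eqVneq (s B) 0.
    have /eqP cB : b == dot c (char_vec R B) by rewrite -subr_eq0 -/(s B) sB0.
    rewrite -cB lerD2l; apply: leb'; rewrite eqQ; split=> //.
    by apply: sub_convex_hull; exists B.
  have : s' B <= N * s B.
    rewrite /N mulr_suml (bigD1 B) ?BK //= divfK //.
    apply: le_trans (ler_norm _) _; rewrite lerDl sumr_ge0 // => B' /andP[/andP[B'K _] _].
    by rewrite mulr_ge0 ?divr_ge0 ?s_ge0.
  by rewrite /s /s'; lra.
(* [N] already makes the inequality valid; the extra unit makes equality force [dot c x = b], so
   that the new face lies inside [Q]. *)
exists ((N + 1) *: c + c'), ((N + 1) * b + b'); rewrite eqQ' eqQ.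
have split_dot x : dot ((N + 1) *: c + c') x = dot (N *: c + c') x + dot c x.
  by rewrite !dotDl !dotZl; ring.
split=> [x hx|].
  by have := leN x hx; have := leb x hx; rewrite -!/(dot _ _) split_dot; lra.
apply/seteqP; split=> x /=; rewrite -!/(dot _ _) split_dot.
  by move=> [[hx eqb] eqb']; split=> //; rewrite dotDl dotZl eqb eqb'; ring.
move=> [hx eqb]; have := leN x hx; have := leb x hx; rewrite -!/(dot _ _).
move: eqb; rewrite dotDl dotZl => eqb le1 le2.
have eqc : dot c x = b by lra.
by split=> //; rewrite eqc in eqb; lra.
Qed.

(** The subdivision consists of all faces of the two cells. *)
Lemma vertex_hull_split K1 K2 P :
  hull K1 `|` hull K2 = P ->
  face (hull K1 `&` hull K2) (hull K1) ->
  face (hull K1 `&` hull K2) (hull K2) ->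
  ~ hull K1 `<=` hull K2 ->
  ~ hull K2 `<=` hull K1 ->
  (forall B, B \in K1 :|: K2 -> vertex (char_vec R B) P) ->
  exists C, is_split C P (hull K1) (hull K2).
Proof.
set Q1 := hull K1; set Q2 := hull K2.
move=> eqUP face1 face2 nsub12 nsub21 vertP.
exists [set Q | face Q Q1 \/ face Q Q2].
have subP Q : face Q Q1 \/ face Q Q2 -> Q `<=` P.
  by rewrite -eqUP => -[] /face_subset sub x /sub; [left | right].
have same K Q Q' : face Q (hull K) -> face Q' (hull K) -> face (Q `&` Q') Q.
  by move=> fQ fQ'; apply: (face_sub fQ (face_setI fQ fQ')) => x [].
have cross K K' Q Q' :
    face (hull K `&` hull K') (hull K) ->
    face (hull K `&` hull K') (hull K') ->
    face Q (hull K) -> face Q' (hull K') ->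
    face (Q `&` Q') Q.
  move=> fD fD' fQ fQ'; set D := _ `&` _ in fD fD'.
  (* Faces of different cells meet inside the common face [D]; their traces there are both faces of
     [D], hence so is the intersection. *)
  have -> : Q `&` Q' = (Q `&` D) `&` (Q' `&` D).
    apply/seteqP; split=> x; last by move=> [[? _] [? _]].
    move=> [Qx Q'x]; have Dx : D x.
      by split; [apply: face_subset Qx | apply: face_subset Q'x].
    by do 2?split.
  apply: (face_sub fQ); last by move=> x [[]].
  apply: (face_trans fD); apply: face_setI.
    by apply: (face_sub fD (face_setI fQ fD)) => x [].
  by apply: (face_sub fD' (face_setI fQ' fD')) => x [].
split.
- split.
  + apply: (@sub_finite_set _ _ (range hull)); last exact: finite_image.
    by move=> Q [/vertex_hull_face[K' _ ->]|/vertex_hull_face[K' _ ->]]; exists K'.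
  + by move=> Q [] /vertex_hull_face[K' _ ->]; apply: vertex_hull_polytope.
  + by move=> Q Q' [fQ|fQ] /(face_trans fQ) fQ'; [left | right].
  + move=> Q Q' [fQ|fQ] [fQ'|fQ']; (split; last rewrite classical_sets.setIC).
    * exact: same fQ fQ'.
    * exact: same fQ' fQ.
    * exact: cross face1 face2 fQ fQ'.
    * by apply: cross fQ' fQ; rewrite classical_sets.setIC.
    * by apply: cross fQ fQ'; rewrite classical_sets.setIC.
    * exact: cross face1 face2 fQ' fQ.
    * exact: same fQ fQ'.
    * exact: same fQ' fQ.
  apply/seteqP; split=> [x [Q /subP sub Qx]|x]; first exact: sub.
  by rewrite -eqUP => -[Qx|Qx]; [exists Q1 | exists Q2] => //; [left | right];
    apply: face_refl.
- move=> Q v CQ vQ.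
  have vhull K : face [set v] (hull K) -> exists2 B, B \in K & v = char_vec R B.
    move=> /vertex_hull_face[K' /fintype.subsetP K'K eqv].
    have : hull K' v by rewrite -eqv.
    move=> [[|k] [p [w [Pp _ w1 _]]]].
      by move: w1; rewrite big_ord0 => /esym/eqP; rewrite oner_eq0.
    have [B BK' eqB] := Pp ord0; exists B; first exact: K'K.
    suff : [set v] (char_vec R B) by [].
    by rewrite eqv; apply: sub_convex_hull; exists B.
  have [fQ|fQ] := CQ; have [B BK ->] := vhull _ (face_trans fQ vQ); apply: vertP.
    by rewrite inE BK.
  by rewrite inE BK orbT.
- by move=> eqQ; apply: nsub12; rewrite eqQ.
move=> Q; split=> [[[fQ|fQ] maxQ]|[->|->]].
- by left; apply/esym/maxQ; [left; apply: face_refl | apply: face_subset].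
- by right; apply/esym/maxQ; [right; apply: face_refl | apply: face_subset].
- split=> [|Q' [fQ'|fQ'] sub]; first by left; apply: face_refl.
    by apply/seteqP; split=> //; apply: face_subset.
  by case: nsub12; apply: classical_sets.subset_trans sub (face_subset fQ').
split=> [|Q' [fQ'|fQ'] sub]; first by right; apply: face_refl.
  by case: nsub21; apply: classical_sets.subset_trans sub (face_subset fQ').
by apply/seteqP; split=> //; apply: face_subset.
Qed.

End Faces.

(** * The two halves of a hypersimplex *)

Section HypersimplexSplit.
Variables (R : realType) (n : nat).
Local Notation V := 'rV[R]_n.
Implicit Types (A B : {set 'I_n}) (x : V).
Local Notation half := (@half_hypersimplex R n).
Local Notation Delta := (@hypersimplex R n).

Lemma sum_setC x A : \sum_i x 0 i = \sum_(i in A) x 0 i + \sum_(i in ~: A) x 0 i.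
Proof.
by rewrite (bigID (mem A)) /=; congr (_ + _); apply: eq_bigl => i; rewrite inE.
Qed.

Lemma half_hypersimplexU d A r : (r <= d)%N ->
  (half d A r `|` half d (~: A) (d - r) = Delta d)%classic.
Proof.
move=> le_rd; apply/seteqP; split=> [x [[]|[]]//|x hx].
have [leA|ltA] := leP (\sum_(i in A) x 0 i) r%:R; [by left | right; split=> //=].
by case: hx => _; rewrite /= (sum_setC x A) natrB //; lra.
Qed.

Lemma half_hypersimplexIP d A r x : (r <= d)%N ->
  (half d A r `&` half d (~: A) (d - r))%classic x <->
  Delta d x /\ \sum_(i in A) x 0 i = r%:R.
Proof.
move=> le_rd; rewrite /half_hypersimplex /=; split=> [[[hx leA] [_ leAc]]|[hx eqA]].
  split=> //; move: leA leAc; case: hx => _; rewrite /= (sum_setC x A) natrB //; lra.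
split; split=> //; rewrite /= ?eqA //.
by case: hx => _; rewrite /= (sum_setC x A) natrB //; lra.
Qed.

Lemma half_hypersimplex_face d A r : (r <= d)%N ->
  face (half d A r `&` half d (~: A) (d - r))%classic (half d A r).
Proof.
move=> le_rd; exists (char_vec R A), r%:R.
split=> [x [_ /= leA]|]; first by rewrite -/(dot _ _) dot_char_vec.
apply/seteqP; split=> x.
  move=> /(half_hypersimplexIP _ _ le_rd)[hx eqA].
  by rewrite /= -/(dot _ _) dot_char_vec eqA; split=> //; split=> //=; rewrite eqA.
rewrite /= -/(dot _ _) dot_char_vec => -[[hx _] eqA].
by apply/half_hypersimplexIP.
Qed.

Definition block_vec A (a b : R) : V := \row_i (if i \in A then a else b).

Lemma sum_block_vec A (a b : R) :
  \sum_(i in A) block_vec A a b 0 i = a * #|A|%:R /\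
  \sum_(i in ~: A) block_vec A a b 0 i = b * #|~: A|%:R.
Proof.
split; rewrite -sumr_const mulr_sumr; apply: eq_bigr => i iA; rewrite mxE mulr1.
  by rewrite iA.
by rewrite inE in iA; rewrite (negPf iA).
Qed.

Lemma half_hypersimplex_notsub d A r : (0 < r <= #|A|)%N -> (r <= d)%N ->
  (d - r < #|~: A|)%N -> ~ (half d A r `<=` half d (~: A) (d - r))%classic.
Proof.
move=> /andP[r_gt0 le_rA] le_rd lt_dr.
(* The witness has total [r - 1] on [A] and [d - r + 1] off [A], one unit beyond the hyperplane,
   spread evenly; the size bounds keep it in the cube. *)
pose a : R := r.-1%:R / #|A|%:R; pose b : R := (d - r).+1%:R / #|~: A|%:R.
have A_gt0 : (0 : R) < #|A|%:R by rewrite ltr0n; lia.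
have Ac_gt0 : (0 : R) < #|~: A|%:R by rewrite ltr0n; lia.
have [sumA sumAc] := sum_block_vec A a b.
rewrite /a /b !divfK ?gt_eqF // in sumA sumAc.
move=> /(_ (block_vec A a b))[|_].
  split; last by rewrite /= sumA ler_nat leq_pred.
  split=> /=; last by rewrite (sum_setC _ A) sumA sumAc -natrD; congr _%:R; lia.
  move=> i; rewrite mxE; case: ifP => _.
    by rewrite divr_ge0 ?ler0n // ler_pdivrMr // mul1r ler_nat; lia.
  by rewrite divr_ge0 ?ler0n // ler_pdivrMr // mul1r ler_nat; lia.
by rewrite /= sumAc ler_nat ltnn.
Qed.

Lemma hypersimplex_vertex d B : #|B| = d -> vertex (char_vec R B) (Delta d).
Proof.
move=> cB; exists (char_vec R B), d%:R; split=> [x [xcube /= sumx]|].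
  rewrite -/(dot _ _) dot_char_vec -sumx (sum_setC x B) lerDl sumr_ge0 // => i _.
  by case/andP: (xcube i).
apply/seteqP; split=> [_ ->|x [[xcube /= sumx]]].
  rewrite /= -/(dot _ _) dot_char_vec sum_char_vec setIid cB; split=> //; split.
    by move=> i; rewrite mxE; case: (i \in B); rewrite ?lexx ?ler01.
  by rewrite /= sumT sum_char_vec setIT cB.
rewrite /= -/(dot _ _) dot_char_vec => sumB.
have eq0 i : i \notin B -> x 0 i = 0.
  move=> iB; have : \sum_(j in ~: B) x 0 j = 0.
    by apply: (addrI (\sum_(j in B) x 0 j)); rewrite -sum_setC sumx sumB addr0.
  move/eqP; rewrite psumr_eq0 => [/allP/(_ i (mem_index_enum _))|j _].
    by rewrite inE iB => /eqP.
  by case/andP: (xcube j).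
have eq1 i : i \in B -> x 0 i = 1.
  move=> iB; have : \sum_(j in B) (1 - x 0 j) = 0.
    by rewrite sumrB sumr_const sumB cB subrr.
  move/eqP; rewrite psumr_eq0 => [/allP/(_ i (mem_index_enum _))|j _].
    by rewrite iB subr_eq0 => /eqP.
  by rewrite subr_ge0; case/andP: (xcube j).
by apply/rowP => i; rewrite mxE; case: (boolP (i \in B)) => [/eq1|/eq0].
Qed.

Lemma hypersimplex_split d A r : (0 < r < #|A|)%N -> (0 < d - r < #|~: A|)%N ->
  exists C, is_split C (Delta d) (half d A r) (half d (~: A) (d - r)).
Proof.
move=> /andP[r_gt0 lt_rA] /andP[dr_gt0 lt_dr]; have le_rd : (r <= d)%N by lia.
have le_dr : (d - r <= d)%N by lia.
have face1 := half_hypersimplex_face A le_rd.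
have := half_hypersimplex_face (~: A) le_dr; rewrite setCK subKn // => face2.
have nsub1 : ~ (half d A r `<=` half d (~: A) (d - r))%classic.
  by apply: half_hypersimplex_notsub; rewrite // r_gt0 ltnW.
have nsub2 : ~ (half d (~: A) (d - r) `<=` half d A r)%classic.
  have := @half_hypersimplex_notsub d (~: A) (d - r); rewrite setCK subKn //.
  by apply=> //; rewrite dr_gt0 ltnW.
have eqU := half_hypersimplexU A le_rd.
rewrite classical_sets.setIC in face2.
move: face1 face2 nsub1 nsub2 eqU; rewrite !half_hypersimplex_hull.
move=> face1 face2 nsub1 nsub2 eqU; apply: vertex_hull_split => // B.
by rewrite !inE => /orP[]/andP[/eqP cB _]; apply: hypersimplex_vertex.
Qed.

End HypersimplexSplit.

(** * Affine hulls and relative interiors *)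

Section AffineRank.
Variables (R : realType) (n : nat).
Local Notation V := 'rV[R]_n.
Implicit Types (P : set V) (c v x : V).

Lemma mulmx_trE m (A : 'M[R]_(m, n)) c i : (A *m c^T) i 0 = dot c (row i A).
Proof. by rewrite mxE; apply: eq_bigr => j _; rewrite !mxE mulrC. Qed.

Lemma sum_comb k (u : 'I_k -> R) (p : 'I_k -> V) (d : R) :
  (forall i, \sum_j p i 0 j = d) ->
  \sum_j (\sum_i u i *: p i) 0 j = (\sum_i u i) * d.
Proof.
move=> sump; under eq_bigr do rewrite summxE.
rewrite exchange_big mulr_suml /=; apply: eq_bigr => i _.
by rewrite -(sump i) mulr_sumr; apply: eq_bigr => j _; rewrite mxE.
Qed.

Section RowSpace.
Variables (d : R) (m : nat) (A : 'M[R]_(m, n)) (P : set V).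
Hypothesis d_neq0 : d != 0.
Hypothesis sumA : forall i, \sum_j row i A 0 j = d.
Hypothesis P_row : forall i, P (row i A).
Hypothesis subP : forall v, P v -> (v <= A)%MS /\ \sum_j v 0 j = d.

(* All points lie on the hyperplane \sum_j x_j = d, which misses the origin, so
   affine and linear independence coincide. *)
Lemma affine_rank_rowspace : affine_rank P (\rank A).
Proof.
have free := maxrowsub_free A; have eqA := eq_maxrowsub A.
set f := maxrankfun A in free eqA.
exists (fun i => row (f i) A); split=> [i|w w0 sw0 i|v Pv]; first exact: P_row.
  have : (\row_i w i) *m rowsub f A = 0.
    by rewrite mulmx_sum_row -[RHS]sw0; apply: eq_bigr => j _; rewrite mxE row_rowsub.
  move/(canRL (mulmxKp free)); rewrite mul0mx => /rowP/(_ i).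
  by rewrite !mxE.
have [vA sumv] := subP Pv; move: vA; rewrite -eqA => /submxP[u eqv].
exists (\rank A), (fun i => row (f i) A), (u 0).
have eqv' : v = \sum_i u 0 i *: row (f i) A.
  by rewrite eqv mulmx_sum_row; apply: eq_bigr => i _; rewrite row_rowsub.
split=> //.
apply: (mulIf d_neq0); rewrite mul1r -[RHS]sumv eqv'.
by rewrite (@sum_comb _ _ _ d).
Qed.

Lemma affine_hull_rowspace :
  affine_hull P = [set v | (v <= A)%MS /\ \sum_j v 0 j = d]%classic.
Proof.
apply/seteqP; split=> v.
  move=> [k [p [w [Pp w1 ->]]]]; split.
    by apply: summx_sub => i _; apply: scalemx_sub; case: (subP (Pp i)).
  rewrite (@sum_comb _ _ _ d) ?w1 ?mul1r // => i.
  by case: (subP (Pp i)).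
move=> [/submxP[u eqv] sumv]; exists m, (fun i => row i A), (u 0).
have eqv' : v = \sum_i u 0 i *: row i A by rewrite eqv mulmx_sum_row.
split=> //; apply: (mulIf d_neq0); rewrite mul1r -[RHS]sumv eqv'.
by rewrite (@sum_comb _ _ _ d).
Qed.

End RowSpace.

Lemma rowspace_full m (A : 'M[R]_(m, n)) :
  (forall c, A *m c^T = 0 -> c = 0) -> \rank A = n.
Proof.
move=> ker0; have : kermx A^T == 0.
  apply/eqP/row_matrixP => i; rewrite row0; apply: ker0.
  apply: trmx_inj; rewrite trmx_mul trmxK trmx0.
  by apply/sub_kermxP; apply: row_sub.
rewrite -mxrank_eq0 mxrank_ker mxrank_tr subn_eq0 => le; apply/eqP.
by rewrite eqn_leq rank_leq_col.
Qed.

Lemma rowspace_hyperplane m (A : 'M[R]_(m, n)) c0 : c0 != 0 -> A *m c0^T = 0 ->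
  (forall c, A *m c^T = 0 -> exists t, c = t *: c0) ->
  \rank A = n.-1 /\ forall v, (v <= A)%MS = (dot c0 v == 0).
Proof.
move=> c0_neq0 Ac0 ker1.
have rkc0 : \rank c0 = 1%N by rewrite rank_rV c0_neq0.
have subA : (A <= kermx c0^T)%MS by apply/sub_kermxP.
have rkK : \rank (kermx c0^T) = n.-1 by rewrite mxrank_ker mxrank_tr rkc0 subn1.
have kerA : (kermx A^T <= c0)%MS.
  apply/row_subP => i; have [|t ->] := ker1 (row i (kermx A^T)).
    apply: trmx_inj; rewrite trmx_mul trmxK trmx0.
    by apply/sub_kermxP; apply: row_sub.
  exact: scalemx_sub.
have rkA : \rank A = n.-1.
  have := mxrankS kerA; have := mxrankS subA; have := rank_leq_col A.
  by rewrite rkK mxrank_ker mxrank_tr rkc0; lia.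
split=> // v; have eqA : (A :=: kermx c0^T)%MS.
  by apply/eqmxP; rewrite -(mxrank_leqif_eq subA) rkA rkK.
rewrite eqA; apply/sub_kermxP/eqP => [eq0|eq0].
  by have := mulmx_trE v c0 0; rewrite eq0 mxE row_id => <-.
by apply/matrixP => i j; rewrite !ord1 mulmx_trE row_id eq0 mxE.
Qed.

Lemma affine_rank_ge P k m (A : 'M[R]_(m, n)) : affine_rank P k ->
  (forall i, P (row i A)) -> (\rank A <= k)%N.
Proof.
move=> [p [_ _ subP]] PA; apply: leq_trans (rank_leq_row (\matrix_i p i)).
apply: mxrankS; apply/row_subP => i; have [l [q [w [qp _ ->]]]] := subP _ (PA i).
apply: summx_sub => j _; apply: scalemx_sub; have [i' _ <-] := qp j.
by rewrite -[p i'](rowK p) row_sub.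
Qed.

(** Homogenised by the relation that the coordinates sum to [d], the two conditions become linear
    forms vanishing on [P]. They are independent, so [P] is too small to be a facet of a polytope of
    affine rank [n]. *)
Lemma affine_rank_two_functionals P k (d s1 s2 : R) (S1 S2 : {set 'I_n}) : d != 0 ->
  S1 \proper S2 -> S1 != set0 -> S2 != setT ->
  (forall x, P x -> [/\ \sum_i x 0 i = d, \sum_(i in S1) x 0 i = s1 &
    \sum_(i in S2) x 0 i = s2]) ->
  affine_rank P k -> (k.+2 <= n)%N.
Proof.
move=> d_neq0 /properP[/fintype.subsetP S12 [j jS2 jS1]] /set0Pn[i iS1] S2T consP.
have [l lS2] : exists l, l \notin S2.
  apply/existsP; apply: contraNT S2T => /existsPn all2; apply/eqP/setP => z.
  by rewrite inE; have := all2 z; rewrite negbK.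
move=> [p [Pp indep _]].
pose f1 : V := d *: char_vec R S1 - s1 *: char_vec R setT.
pose f2 : V := d *: char_vec R S2 - s2 *: char_vec R setT.
pose A : 'M[R]_(k, n) := \matrix_i p i; pose L : 'M[R]_(1 + 1, n) := col_mx f1 f2.
have dotf x : P x -> dot f1 x = 0 /\ dot f2 x = 0.
  move=> /consP[sumx sum1 sum2].
  rewrite !dotDl -!scaleNr !dotZl !dot_char_vec -sumT sumx sum1 sum2.
  by split; ring.
have rkA : \rank A = k.
  apply/eqP/inj_row_free => v; rewrite mulmx_sum_row.
  have eqv : \sum_a v 0 a *: row a A = \sum_a v 0 a *: p a.
    by apply: eq_bigr => a _; rewrite rowK.
  rewrite eqv => sv0; have sum0 : \sum_a v 0 a = 0.
    apply: (mulIf d_neq0); rewrite mul0r -(@sum_comb _ _ p) => [|a].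
      by rewrite sv0 big1 // => z _; rewrite mxE.
    by case: (consP _ (Pp a)).
  by apply/rowP => a; rewrite (indep _ sum0 sv0) mxE.
have rkL : \rank L = 2%N.
  apply/eqP/inj_row_free => v; rewrite -[v]hsubmxK mul_row_col.
  rewrite [lsubmx v]mx11_scalar [rsubmx v]mx11_scalar !mul_scalar_mx.
  set a := lsubmx v 0 0; set b := rsubmx v 0 0 => /rowP eq0.
  (* One index from each of [S1], [S2 :\: S1] and [~: S2]; differences of the three equations
     isolate [a * d] and [b * d]. *)
  have := eq0 i; have := eq0 j; have := eq0 l; rewrite !mxE !in_setT iS1 jS2.
  rewrite (negPf jS1) (negPf lS2) (S12 _ iS1) (contraNF (S12 l) lS2).
  rewrite !mulr0 !mulr1 !sub0r => eql eqj eqi.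
  have /eqP : a * d = 0 by lra.
  have /eqP : b * d = 0 by lra.
  by rewrite !mulf_eq0 (negPf d_neq0) !orbF => /eqP-> /eqP->; rewrite raddf0 row_mx0.
have AL : A *m L^T = 0.
  rewrite tr_col_mx mul_mx_row -[RHS]row_mx0; congr row_mx; apply/matrixP => a b;
    rewrite !ord1 mulmx_trE rowK mxE; by case: (dotf _ (Pp a)).
have := mulmx0_rank_max AL; by rewrite rkA mxrank_tr rkL addn2.
Qed.

End AffineRank.

(** * Points on both sides of a split hyperplane *)

Section SplitSides.
Variables (R : realType) (n : nat).
Local Notation V := 'rV[R]_n.
Implicit Types (P Q H : set V) (c v x : V).
Local Open Scope classical_set_scope.

Lemma affine_hull_dot P c (b : R) : (forall p, P p -> dot c p = b) ->
  forall x, affine_hull P x -> dot c x = b.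
Proof.
move=> eqb _ [k [p [w [Pp w1 ->]]]]; rewrite dot_comb -[RHS]mul1r -[X in X * _]w1.
by rewrite mulr_suml; apply: eq_bigr => i _; rewrite eqb.
Qed.

Lemma sub_affine_hull P : P `<=` affine_hull P.
Proof.
move=> x Px; exists 1%N, (fun=> x), (fun=> 1); split=> //; first by rewrite big_ord1.
by rewrite big_ord1 scale1r.
Qed.

Lemma convex_hull_cone P k (p : 'I_k -> V) (w : 'I_k -> R) (a : R) x :
  convex_hull P x -> 0 < a -> (forall i, convex_hull P (p i)) ->
  (forall i, 0 <= w i) ->
  convex_hull P ((a + \sum_i w i)^-1 *: (a *: x + \sum_i w i *: p i)).
Proof.
move=> Px a_gt0 Pp w0; set N := a + _.
have N_gt0 : 0 < N by rewrite ltr_pwDl // sumr_ge0.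
have -> : N^-1 *: (a *: x + \sum_i w i *: p i) =
    \sum_(i < k.+1) (oapp w a (unlift ord0 i) / N) *: oapp p x (unlift ord0 i).
  rewrite big_ord_recl unlift_none /= scalerDr scalerA mulrC; congr (_ + _).
  rewrite scaler_sumr; apply: eq_bigr => i _.
  by rewrite liftK /= scalerA mulrC.
apply: convex_hull_sum => [i|i|]; first by case: unliftP => [j _|_] /=.
  by rewrite divr_ge0 ?(ltW N_gt0) //; case: unliftP => [j _|_] /=; rewrite // ltW.
rewrite -mulr_suml big_ord_recl unlift_none /=.
by under eq_bigr do rewrite liftK /=; rewrite divff ?gt_eqF.
Qed.

(* If Q1 and Q2 had points a and b on the same open side of the split hyperplane,
   then a combination of b with points of Q1 `&` Q2 would also be a combination
   of a with points of Q1 `&` Q2, hence lie in Q1 `&` Q2 off the hyperplane. *)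
Lemma split_sides P H c (b : R) :
  H `&` affine_hull P = [set x | affine_hull P x /\ dot c x = b] ->
  (exists v, affine_hull P v /\ dot c v = b) ->
  defines_split H P -> exists x y, [/\ P x, P y, dot c x < b & b < dot c y].
Proof.
move=> eqH [v [Pv vb]] [C [Q1 [Q2 [[[_ polyC _ faceC eqUP] _ neqQ maxC] _ eqaff]]]].
set D := Q1 `&` Q2 in eqaff; rewrite eqH in eqaff.
have [CQ1 max1] : maximal_cell C Q1 by apply/maxC; left.
have [CQ2 max2] : maximal_cell C Q2 by apply/maxC; right.
have sub1 : Q1 `<=` P by move=> x Q1x; rewrite -eqUP; exists Q1.
have sub2 : Q2 `<=` P by move=> x Q2x; rewrite -eqUP; exists Q2.
have [z Dz] : exists z, D z.
  have : affine_hull D v by rewrite eqaff.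
  move=> [[|k] [p [w [Dp w1 _]]]]; last by exists (p ord0).
  by move: w1; rewrite big_ord0 => /esym/eqP; rewrite oner_eq0.
have Db x : D x -> dot c x = b.
  by move=> /sub_affine_hull; rewrite eqaff => -[].
have off Q : face D Q -> Q `<=` P -> ~ Q `<=` D -> exists2 x, Q x & dot c x != b.
  move=> [c' [b' [leb' eqD]]] subQ nsub; apply: contrapT => nex; apply: nsub => x Qx.
  have xb : dot c x = b.
    by apply: contrapT => /eqP neb; apply: nex; exists x.
  rewrite eqD; split=> //; rewrite /= -/(dot _ _).
  apply: (@affine_hull_dot D) => [p|]; first by rewrite eqD => -[].
  by rewrite eqaff; split=> //; apply/sub_affine_hull/subQ.
have [face1 face2] := faceC _ _ CQ1 CQ2.
have [a Q1a neqa] : exists2 x, Q1 x & dot c x != b.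
  apply: off face1 sub1 _ => sub; apply: neqQ; apply/esym/max1 => //.
  by move=> x /sub[].
have [a' Q2a' neqa'] : exists2 x, Q2 x & dot c x != b.
  apply: off face2 sub2 _ => sub; apply: neqQ; apply/max2 => //.
  by move=> x /sub[].
suff : (dot c a - b) * (dot c a' - b) < 0.
  have [ltab|] := ltrP (dot c a) b; last rewrite le_eqVlt eq_sym (negPf neqa) /=.
    by rewrite nmulr_rlt0 ?subr_lt0 // subr_gt0 => ltb; exists a, a'; split; auto.
  move=> ltba; rewrite pmulr_rlt0 ?subr_gt0 // subr_lt0 => ltb.
  by exists a', a; split; auto.
rewrite lt_neqAle mulf_neq0 ?subr_eq0 //= leNgt; apply/negP => same.
pose beta := (dot c a' - b) / (dot c a - b).
have beta_gt0 : 0 < beta.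
  have -> : beta = (dot c a - b) * (dot c a' - b) / (dot c a - b) ^+ 2.
    by rewrite /beta; field; rewrite subr_eq0.
  by rewrite divr_gt0 // lt_neqAle sqr_ge0 eq_sym expf_neq0 ?subr_eq0.
have : affine_hull D (a' + beta *: (z - a)).
  rewrite eqaff; split.
    exists 3%N, (fun i => nth 0 [:: a'; z; a] i), (fun i => nth 0 [:: 1; beta; - beta] i).
    split.
    - by case=> [[|[|[|i]]]] //= _; [apply: sub2 | apply: sub1; case: Dz | apply: sub1].
    - by rewrite !big_ord_recl big_ord0 /=; ring.
    by rewrite !big_ord_recl big_ord0 /= addr0 scale1r scalerBr scaleNr.
  rewrite dotDr dotZr dotDr -scaleN1r dotZr (Db z Dz).
  by rewrite /beta; field; rewrite subr_eq0.
move=> [k [q [g [Dq g1 eqw]]]].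
pose s := \sum_i `|g i|; have s_ge0 : 0 <= s by apply: sumr_ge0.
(* The affine coefficients [g i] may be negative. Adding the weights [|g i|] to both sides of the
   relation [eqw] makes all coefficients nonnegative, so that [y] is a convex combination in [Q2]
   (using [a']) and in [Q1] (using [a]). *)
pose y := (1 + s + beta)^-1 *: (a' + beta *: z + \sum_i `|g i| *: q i).
have N_gt0 : 0 < 1 + s + beta by lra.
have [s1 Q1E] := polyC _ CQ1; have [s2 Q2E] := polyC _ CQ2.
have Q2y : Q2 y.
  pose u := (1 + s)^-1 *: (1 *: a' + \sum_i `|g i| *: q i).
  have Q2u : Q2 u.
    rewrite Q2E; apply: convex_hull_cone; rewrite -?Q2E // => i.
    by case: (Dq i).
  have -> : y = ((1 + s) / (1 + s + beta)) *: u + (beta / (1 + s + beta)) *: z.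
    have eu : (1 + s) *: u = a' + \sum_i `|g i| *: q i.
      by rewrite /u scale1r scalerA divff ?scale1r // gt_eqF //; lra.
    by rewrite ![_ / (1 + s + beta)]mulrC -2!scalerA eu -scalerDr /y [a' + _ + _]addrAC.
  rewrite Q2E; apply: convex_hullP; rewrite -?Q2E //; first by case: Dz.
  - by rewrite divr_ge0 //; lra.
  - by rewrite divr_ge0 //; lra.
  by rewrite -mulrDl divff // gt_eqF.
have Q1y : Q1 y.
  have sumgg : \sum_i (g i + `|g i|) = 1 + s by rewrite big_split /= g1.
  have -> : y = (beta + \sum_i (g i + `|g i|))^-1 *:
      (beta *: a + \sum_i (g i + `|g i|) *: q i).
    rewrite sumgg [beta + _]addrC /y; congr (_ *: _).
    under [in RHS]eq_bigr do rewrite scalerDl.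
    rewrite big_split /= -eqw scalerBr [RHS]addrA; congr (_ + _).
    by rewrite [RHS]addrC !addrA subrK.
  rewrite Q1E; apply: convex_hull_cone; rewrite -?Q1E // => i.
    by case: (Dq i).
  by have := ler_norm (- g i); rewrite normrN; lra.
have : dot c y = b by apply: Db.
rewrite /y dotZr !dotDr dotZr dot_comb (Db z Dz).
rewrite (eq_bigr (fun i => `|g i| * b)) => [|i _]; last by rewrite (Db _ (Dq i)).
rewrite -mulr_suml -/s => /(congr1 (fun t => (1 + s + beta) * t)).
rewrite mulVKf ?gt_eqF // => eqb.
by case/eqP: neqa'; lra.
Qed.

End SplitSides.

(** * Relative interior of the hypersimplex *)

Section RelativeInterior.
Variables (R : realType) (n : nat) (d : nat).
Local Notation V := 'rV[R]_n.
Local Notation Delta := (@hypersimplex R n d).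
Hypothesis n_ge2 : (2 <= n)%N.
Hypothesis aff_Delta :
  affine_hull Delta = [set x : V | \sum_i x 0 i = d%:R]%classic.

Lemma relint_hypersimplexP (x : V) :
  relint Delta x <-> \sum_i x 0 i = d%:R /\ forall i, 0 < x 0 i < 1.
Proof.
rewrite /relint aff_Delta; split=> [[[xcube /= sumx] nearx]|[/= sumx x01]].
  split=> // i; have /nbhs_ballP[e /= e_gt0 ballP] := nearx.
  have [j neji] : exists j : 'I_n, j != i.
    have [eqi|neqi] := eqVneq i (Ordinal (ltnW n_ge2)).
      by exists (Ordinal n_ge2); rewrite eqi.
    by exists (Ordinal (ltnW n_ge2)); rewrite eq_sym.
  (* Changing the coordinate [i] alone would leave the affine hull; a second coordinate [j]
     compensates. *)
  have shift (t : R) : `|t| < e -> 0 <= x 0 i + t <= 1.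
    move=> lte; pose y : V := \row_k (x 0 k + t * ((k == i)%:R - (k == j)%:R)).
    suff [/(_ i)] : Delta y.
      by rewrite mxE eqxx eq_sym (negPf neji) subr0 mulr1.
    apply: (ballP y); last first.
      rewrite /= -sumx; under eq_bigr do rewrite mxE.
      have sum1 l : \sum_k (k == l)%:R = 1 :> R.
        by rewrite (bigD1 l) //= eqxx big1 ?addr0 // => k /negPf->.
      by rewrite big_split /= -mulr_sumr sumrB !sum1 subrr mulr0 addr0.
    split=> // z k; rewrite ord1 -ball_normE /= !mxE opprD addrA subrr sub0r normrN.
    rewrite normrM; apply: le_lt_trans lte; rewrite ler_piMr //.
    by case: eqP => _; case: eqP => _; rewrite ?subrr ?subr0 ?sub0r ?normrN ?normr0 ?normr1.
  have lt2 : e / 2 < e by lra.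
  have := shift (e / 2); have := shift (- (e / 2)).
  rewrite normrN gtr0_norm; last by lra.
  by move=> /(_ lt2)/andP[? ?] /(_ lt2)/andP[? ?]; lra.
have xcube : unit_cube x by move=> i; have /andP[? ?] := x01 i; rewrite !ltW.
split=> //.
pose e := \big[Num.min/1]_i Num.min (x 0 i) (1 - x 0 i).
have e_gt0 : 0 < e.
  apply: lt_bigmin => // i _; have /andP[? ?] := x01 i.
  by rewrite lt_min subr_gt0; apply/andP.
apply/nbhs_ballP; exists e => //= y [_ bally] sumy; split=> // i.
have := bally 0 i; rewrite -ball_normE /= => lte.
have : e <= Num.min (x 0 i) (1 - x 0 i) by apply: bigmin_le.
rewrite le_min => /andP[le1 le2]; move: lte; rewrite ltr_norml => /andP[? ?].
by apply/andP; split; lra.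
Qed.

End RelativeInterior.

(** * Split flacets *)

Section MatroidPolytope.
Variables (R : realType) (n : nat) (M : matroid 'I_n).
Local Notation V := 'rV[R]_n.
Local Notation d := (rank M).
Local Notation chi := (@char_vec R n).
Local Notation PM := (@matroid_polytope R n M).
Local Notation Delta := (@hypersimplex R n d).
Implicit Types (P : set V) (B F G S : {set 'I_n}) (x v c : V).
Hypothesis n_ge2 : (2 <= n)%N.
Hypothesis conM : connected_between (rk M) set0 setT.
Hypothesis d_gt0 : (0 < d)%N.

Let d_neq0 : (d%:R : R) != 0.
Proof. by rewrite pnatr_eq0 -lt0n. Qed.

Lemma sum_basis B : is_basis M B -> \sum_i chi B 0 i = d%:R.
Proof. by move=> basisB; rewrite sumT sum_char_vec setIT (basis_card basisB). Qed.

Lemma sum_face_basis G B : face_basis M G B -> \sum_(i in G) chi B 0 i = (rk M G)%:R.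
Proof. by case/andP => _ /eqP cB; rewrite sum_char_vec cB. Qed.

Lemma matroid_polytope_basis B : is_basis M B -> PM (chi B).
Proof. by move=> basisB; apply: sub_convex_hull; exists B. Qed.

Lemma matroid_polytope_sum_le G x : PM x -> \sum_(i in G) x 0 i <= (rk M G)%:R.
Proof.
rewrite -dot_char_vec; apply: convex_hull_le => _ [B basisB <-].
by rewrite dot_char_vec sum_char_vec ler_nat basis_cardI.
Qed.

Lemma matroid_polytope_sum x : PM x -> \sum_i x 0 i = d%:R.
Proof.
move=> [k [p [w [Pp _ w1 ->]]]]; rewrite sumT -dot_char_vec.
apply: (@affine_hull_dot _ _ PM) => [q|]; last first.
  by exists k, p, w; split=> // i; apply: sub_convex_hull.
move=> [l [q' [u [Pq' _ u1 ->]]]]; rewrite dot_comb -[RHS]mul1r -[X in X * _]u1 mulr_suml.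
apply: eq_bigr => i _; congr (_ * _); have [B basisB <-] := Pq' i.
by rewrite dot_char_vec -sumT sum_basis.
Qed.

Lemma flat_hyperplaneE G x : \sum_i x 0 i = d%:R ->
  flat_hyperplane M G x <-> \sum_(i in G) x 0 i = (rk M G)%:R.
Proof.
rewrite (sum_setC x G) /flat_hyperplane /= => sumx.
have -> : \sum_(j in ~: G) x 0 j = d%:R - \sum_(i in G) x 0 i by rewrite -sumx; ring.
split=> [eqG|->]; last by ring.
by apply: (mulfI d_neq0); lra.
Qed.

Definition family_mx (K : {set {set 'I_n}}) : 'M[R]_(#|K|, n) :=
  \matrix_i chi (enum_val i).

Lemma family_mx_ker K c : family_mx K *m c^T = 0 ->
  forall B, B \in K -> \sum_(i in B) c 0 i = 0.
Proof.
move=> Kc0 B BK; have := mulmx_trE (family_mx K) c (enum_rank_in BK B).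
by rewrite Kc0 mxE rowK enum_rankK_in // dot_char_vecr.
Qed.

Lemma rank_bases : \rank (family_mx [set B | is_basis M B]) = n.
Proof.
apply: rowspace_full => c /family_mx_ker sum0.
have cst (x y : 'I_n) : c 0 x = c 0 y.
  apply: (@face_basis_functional _ M R (fun i => c 0 i) setT conM) => //.
  - exact: connected_between_refl.
  - by move=> B B' /andP[basisB _] /andP[basisB' _]; rewrite !sum0 ?inE.
  by rewrite !inE.
have [B /andP[basisB _]] := face_basis_exists M set0.
apply/rowP => x; rewrite mxE; apply/eqP.
have := sum0 B; rewrite inE => /(_ basisB).
under eq_bigr do rewrite (cst _ x).
by rewrite sumr_const (basis_card basisB) => /eqP; rewrite mulrn_eq0 -leqn0 leqNgt d_gt0.
Qed.

(** Any [P] between the basis vectors and the hyperplane is allowed, so that the matroid polytope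
    and the hypersimplex are treated together. *)
Lemma bases_span P : (forall B, is_basis M B -> P (chi B)) ->
  (forall x, P x -> \sum_i x 0 i = d%:R) ->
  affine_rank P n /\ affine_hull P = [set x : V | \sum_i x 0 i = d%:R]%classic.
Proof.
move=> Pbasis sumP; set A := family_mx [set B | is_basis M B].
have basisA i : is_basis M (enum_val (A := [set B | is_basis M B]) i).
  by have := enum_valP i; rewrite inE.
have sumA i : \sum_j row i A 0 j = d%:R by rewrite rowK sum_basis.
have PA i : P (row i A) by rewrite rowK; apply: Pbasis.
have subA v : (v <= A)%MS by apply: submx_full; rewrite /row_full rank_bases.
have subP v : P v -> (v <= A)%MS /\ \sum_j v 0 j = d%:R by move=> /sumP.
split; first by rewrite -[X in affine_rank _ X]rank_bases; apply: affine_rank_rowspace subP.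
rewrite (affine_hull_rowspace d_neq0 sumA PA subP); apply/seteqP; split=> v.
  by case.
by split.
Qed.

Section Face.
Variable G : {set 'I_n}.
Hypothesis con0G : connected_between (rk M) set0 G.
Hypothesis conGT : connected_between (rk M) G setT.
Hypothesis rkG_gt0 : (0 < rk M G)%N.
Hypothesis rkG_lt : (rk M G < d)%N.

Let K := [set B | face_basis M G B].

Lemma face_span P : (forall B, face_basis M G B -> P (chi B)) ->
  (forall x, P x -> \sum_i x 0 i = d%:R /\ \sum_(i in G) x 0 i = (rk M G)%:R) ->
  affine_rank P n.-1 /\ affine_hull P =
    [set x : V | \sum_i x 0 i = d%:R /\ \sum_(i in G) x 0 i = (rk M G)%:R]%classic.
Proof.
move=> Pface sumP; set A := family_mx K.
have faceA i : face_basis M G (enum_val (A := K) i).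
  by have := enum_valP i; rewrite inE.
have sumA i : \sum_j row i A 0 j = d%:R.
  by rewrite rowK sum_basis //; case/andP: (faceA i).
have PA i : P (row i A) by rewrite rowK; apply: Pface.
(* [c0] is the homogeneous equation of the [G]-hyperplane; on vectors of total [d] it equals [d]
   times the deviation of the sum over [G] from [r]. *)
pose r : R := (rk M G)%:R; pose c0 : V := block_vec G (d%:R - r) (- r).
have dotc0 v : \sum_j v 0 j = d%:R ->
    (dot c0 v == 0) = (\sum_(i in G) v 0 i == r).
  move=> sumv; have -> : dot c0 v = d%:R * (\sum_(i in G) v 0 i - r).
    have -> : dot c0 v = (d%:R - r) * \sum_(i in G) v 0 i + - r * \sum_(i in ~: G) v 0 i.
      rewrite /dot (bigID (mem G)) /= !mulr_sumr; congr (_ + _).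
        by apply: eq_bigr => i iG; rewrite mxE iG.
      apply: eq_big => [i|i /negPf iG]; first by rewrite inE.
      by rewrite mxE iG.
    by move: sumv; rewrite (sum_setC v G) => <-; ring.
  by rewrite mulf_eq0 (negPf d_neq0) subr_eq0.
have [||c Ac0|rkA subA] := @rowspace_hyperplane _ _ _ A c0.
- have [i iG] : exists i, i \in G.
    apply/set0Pn; apply: contraTneq rkG_gt0 => ->; by rewrite rk_set0.
  apply: contraTneq isT => /rowP/(_ i); rewrite !mxE iG => /eqP.
  by rewrite subr_eq0 eqr_nat gtn_eqF.
- apply/matrixP => i j; rewrite ord1 mulmx_trE mxE; apply/eqP.
  by rewrite dotc0 // rowK sum_face_basis.
- have sum0 B : face_basis M G B -> \sum_(i in B) c 0 i = 0.
    by move=> faceB; apply: (family_mx_ker Ac0); rewrite inE.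
  have cst (x y : 'I_n) : (x \in G) = (y \in G) -> c 0 x = c 0 y.
    apply: (@face_basis_functional _ M R (fun i => c 0 i) G con0G conGT) => B B' fB fB'.
    by rewrite !sum0.
  have [B faceB] := face_basis_exists M G.
  have [basisB /eqP cBG] := andP faceB.
  have [i iG] : exists i, i \in G.
    apply/set0Pn; apply: contraTneq rkG_gt0 => ->; by rewrite rk_set0.
  have [j jG] : exists j, j \notin G.
    apply/existsP; apply: contraTT rkG_lt => /existsPn all2; rewrite -leqNgt.
    rewrite /rank (_ : G = setT) //; apply/setP => z; rewrite inE.
    by have := all2 z; rewrite negbK.
  (* A face basis has [r] elements in [G] and [d - r] outside, which fixes the ratio of the two
     values of [c] to that of [c0]. *)
  have : c 0 i * r + c 0 j * (d%:R - r) = 0.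
    rewrite -(sum0 B faceB) (bigID (mem G)) /=.
    rewrite (eq_bigr (fun=> c 0 i)) => [|k /andP[_ kG]]; last by apply: cst; rewrite kG.
    rewrite [X in _ = _ + X](eq_bigr (fun=> c 0 j)) => [|k /andP[_ kG]]; last first.
      by apply: cst; rewrite (negPf kG) (negPf jG).
    rewrite !sumr_const -[X in _ = X + _]mulr_natr -[X in _ = _ + X]mulr_natr.
    congr (_ * _ + _ * _).
      by rewrite /r -cBG; congr _%:R; apply: eq_card => k; rewrite !inE.
    rewrite /r -cBG -(basis_card basisB) -(cardsID G B) natrD addrC addKr.
    by congr _%:R; apply: eq_card => k; rewrite !inE andbC.
  have dr_neq0 : d%:R - r != 0 by rewrite subr_eq0 eqr_nat gtn_eqF.
  move=> eq0; exists (c 0 i / (d%:R - r)); apply/rowP => k; rewrite !mxE.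
  have [kG|kG] := boolP (k \in G).
    by rewrite divfK //; apply: cst; rewrite kG.
  rewrite (cst k j); last by rewrite (negPf kG) (negPf jG).
  apply: (mulIf dr_neq0); rewrite mulrAC divfK //.
  by apply: (addrI (c 0 i * r)); rewrite eq0; ring.
have subP v : P v -> (v <= A)%MS /\ \sum_j v 0 j = d%:R.
  by move=> /sumP[sumv sumG]; rewrite subA dotc0 // sumG eqxx.
split; first by rewrite -rkA; apply: affine_rank_rowspace subP.
rewrite (affine_hull_rowspace d_neq0 sumA PA subP); apply/seteqP; split=> v.
  by rewrite /= subA => -[eqv sumv]; split=> //; apply/eqP; rewrite -dotc0.
by move=> [sumv sumG]; split=> //; rewrite subA dotc0 // sumG.
Qed.

End Face.

Lemma hypersimplex_basis B : is_basis M B -> Delta (chi B).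
Proof.
move=> basisB; have [c [b [_ eqv]]] := hypersimplex_vertex R (basis_card basisB).
by have : [set chi B]%classic (chi B) by []; rewrite eqv => -[].
Qed.

Lemma affine_hull_hypersimplex :
  affine_hull Delta = [set x : V | \sum_i x 0 i = d%:R]%classic.
Proof.
apply: (bases_span (P := Delta) _ _).2 => [B|x []//]; exact: hypersimplex_basis.
Qed.

End MatroidPolytope.

Section SplitFlacets.
Variables (R : realType) (n : nat) (M : matroid 'I_n).
Local Notation V := 'rV[R]_n.
Local Notation d := (rank M).
Local Notation chi := (@char_vec R n).
Local Notation PM := (@matroid_polytope R n M).
Local Notation Delta := (@hypersimplex R n d).
Implicit Types (P : set V) (A B F G S U : {set 'I_n}) (x v c : V).
Hypothesis n_ge2 : (2 <= n)%N.
Hypothesis conM : connected_between (rk M) set0 setT.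
Hypothesis d_gt0 : (0 < d)%N.

Lemma sum_setUI (x : V) S U : \sum_(i in S :|: U) x 0 i + \sum_(i in S :&: U) x 0 i =
  \sum_(i in S) x 0 i + \sum_(i in U) x 0 i.
Proof.
rewrite !(big_mkcond (fun i => i \in _)) -!big_split; apply: eq_bigr => i _ /=.
by rewrite !inE; case: (i \in S); case: (i \in U); rewrite /= ?addr0 ?add0r.
Qed.

Lemma sum_indicator B G : \sum_(k in B) ((k \in G)%:R : R) = \sum_(k in G) chi B 0 k.
Proof.
rewrite [LHS]big_mkcond [RHS]big_mkcond; apply: eq_bigr => k _; rewrite mxE.
by case: (k \in B); case: (k \in G).
Qed.

Lemma flat_hyperplane_affine_hull G :
  (flat_hyperplane M G `&` affine_hull Delta)%classic =
  [set x : V | \sum_i x 0 i = d%:R /\ \sum_(i in G) x 0 i = (rk M G)%:R]%classic.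
Proof.
rewrite affine_hull_hypersimplex //; apply/seteqP; split=> x.
  by move=> [/= HGx sumx]; split=> //; apply/flat_hyperplaneE.
by move=> [/= sumx sumG]; split=> //; apply/flat_hyperplaneE.
Qed.

Lemma split_flacetI G :
  connected_between (rk M) set0 G -> connected_between (rk M) G setT ->
  (0 < rk M G < #|G|)%N -> (0 < d - rk M G < #|~: G|)%N -> split_flacet R M G.
Proof.
move=> con0G conGT rkG rkGc; have rkG_gt0 : (0 < rk M G)%N by case/andP: rkG.
have rkG_lt : (rk M G < d)%N by lia.
have span := face_span d_gt0 con0G conGT rkG_gt0 rkG_lt.
have n_eq : n = n.-1.+1 by lia.
have faceP B : face_basis M G B -> (@flat_face R n M) G (chi B).
  move=> faceB; split; last exact: sum_face_basis.
  by apply: matroid_polytope_basis; case/andP: faceB.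
have [i iG] : exists i, i \in G by apply/card_gt0P; lia.
have [j jG] : exists j, j \notin G.
  by have /card_gt0P[j] : (0 < #|~: G|)%N; [lia | rewrite inE => jG; exists j].
split; first split.
- exact: flat_connected_between.
- split.
    exists (chi G), (rk M G)%:R; split=> [x PMx|].
      by rewrite -/(dot _ _) dot_char_vec; apply: matroid_polytope_sum_le.
    by apply/seteqP; split=> x; rewrite /= -/(dot _ _) dot_char_vec.
  exists n.-1; rewrite -n_eq; split.
    apply: (span R _ faceP _).1 => x [PMx sumG]; split=> //.
    exact: matroid_polytope_sum PMx.
  apply: (bases_span conM d_gt0 _ _).1 => [B|x]; first exact: matroid_polytope_basis.
  exact: matroid_polytope_sum.
(* The indicator of [G'] is constant on the bases of the face, hence on [G], so [G'] is [G] or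
   empty. The empty set defines the whole polytope; then the indicator of [G] would be constant on
   all bases, hence on the ground set. *)
- move=> G' _ eqface /subsetP subG.
  have faceG' B : face_basis M G B -> \sum_(k in B) ((k \in G')%:R : R) = (rk M G')%:R.
    by move=> /faceP; rewrite -eqface => -[_ /= <-]; exact: sum_indicator.
  have cst (x y : 'I_n) : (x \in G) = (y \in G) -> ((x \in G')%:R : R) = (y \in G')%:R.
    apply: (@face_basis_functional _ M R (fun k => (k \in G')%:R) G con0G conGT).
    by move=> B B' /faceG' -> /faceG' ->.
  have [iG'|iG'] := boolP (i \in G').
    apply/setP => k; apply/idP/idP => [/subG//|kG].
    have := cst k i; rewrite kG iG iG' => /(_ erefl).
    by case: (k \in G') => // /esym/eqP; rewrite oner_eq0.
  have G'0 : G' = set0.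
    apply/setP => k; rewrite inE; apply/negbTE/negP => kG'.
    have := cst k i; rewrite (subG k kG') iG kG' (negPf iG') => /(_ erefl)/eqP.
    by rewrite oner_eq0.
  have faceT B : is_basis M B -> \sum_(k in B) ((k \in G)%:R : R) = (rk M G)%:R.
    move=> basisB; have : (@flat_face R n M) G' (chi B).
      split; first exact: matroid_polytope_basis.
      by rewrite /= G'0 big_set0 rk_set0.
    by rewrite eqface => -[_ /= <-]; exact: sum_indicator.
  have : ((i \in G)%:R : R) = (j \in G)%:R.
    apply: (@face_basis_functional _ M R (fun k => (k \in G)%:R) setT conM).
    - exact: connected_between_refl.
    - by move=> B B' /andP[/faceT -> _] /andP[/faceT -> _].
    by rewrite !inE.
  by rewrite iG (negPf jG) => /eqP; rewrite oner_eq0.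
have le_rd := ltnW rkG_lt.
have [C splitC] := @hypersimplex_split R n d G (rk M G) rkG rkGc.
exists C, (half_hypersimplex d G (rk M G)), (half_hypersimplex d (~: G) (d - rk M G)).
have Dspan := span R (half_hypersimplex d G (rk M G) `&`
  half_hypersimplex d (~: G) (d - rk M G))%classic.
have [||rkD affD] := Dspan.
- move=> B faceB; apply/(half_hypersimplexIP _ _ le_rd); split.
    by apply: hypersimplex_basis; case/andP: faceB.
  exact: sum_face_basis.
- by move=> x /(half_hypersimplexIP _ _ le_rd)[[_ /= sumx] sumG].
split=> //; last by rewrite affD flat_hyperplane_affine_hull.
exists n.-1; split=> //; rewrite -n_eq.
apply: (bases_span conM d_gt0 _ _).1 => [B|x []//]; exact: hypersimplex_basis.
Qed.

(** The strict bounds come from hypersimplex points on both sides of the hyperplane. Connectedness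
    comes from the dimension: the rank bounds of a separating pair add up to an equality on the
    face, so one of them is a second independent equation there. *)
Lemma split_flacetE F : split_flacet R M F ->
  [/\ flat M F, connected_between (rk M) set0 F, connected_between (rk M) F setT,
    (0 < rk M F < #|F|)%N & (0 < d - rk M F < #|~: F|)%N].
Proof.
move=> [[flatF [_ [k [rkface rkPM]]] _] splitF].
have n_le : (n <= k.+1)%N.
  rewrite -[X in (X <= _)%N](rank_bases R conM d_gt0).
  apply: affine_rank_ge rkPM _ => i; rewrite rowK; apply: matroid_polytope_basis.
  by have := enum_valP i; rewrite inE.
have [B faceB] := face_basis_exists M F.
have basisB : is_basis M B by case/andP: faceB.
have [|||x [y [[xcube /= sumx] [ycube /= sumy]]]] :=
    @split_sides R n Delta (flat_hyperplane M F) (chi F) (rk M F)%:R.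
- rewrite flat_hyperplane_affine_hull affine_hull_hypersimplex //.
  by apply/seteqP; split=> x [/= sumx]; rewrite ?dot_char_vec => sumF; split=> //=;
    rewrite ?dot_char_vec.
- exists (chi B); rewrite dot_char_vec (sum_face_basis R faceB); split=> //.
  exact/sub_affine_hull/hypersimplex_basis.
- exact: splitF.
rewrite !dot_char_vec => ltx lty.
have bounds (z : V) S : unit_cube z -> 0 <= \sum_(i in S) z 0 i <= #|S|%:R.
  move=> zcube; apply/andP; split; first by apply: sumr_ge0 => i _; case/andP: (zcube i).
  by rewrite -sumr_const; apply: ler_sum => i _; case/andP: (zcube i).
have /andP[xF0 xF1] := bounds x F xcube; have /andP[xc0 xc1] := bounds x (~: F) xcube.
have /andP[yF0 yF1] := bounds y F ycube; have /andP[yc0 yc1] := bounds y (~: F) ycube.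
move: sumx sumy; rewrite (sum_setC x F) (sum_setC y F) => sumx sumy.
have rkF_gt0 : (0 < rk M F)%N by rewrite -(ltr_nat R); lra.
have rkF_lt : (rk M F < #|F|)%N by rewrite -(ltr_nat R); lra.
have rkF_ltd : (rk M F < d)%N by rewrite -(ltr_nat R); lra.
have d_lt : (d < rk M F + #|~: F|)%N by rewrite -(ltr_nat R) natrD; lra.
have sumface x' : (@flat_face R n M) F x' ->
    \sum_i x' 0 i = d%:R /\ \sum_(i in F) x' 0 i = (rk M F)%:R.
  by move=> [/matroid_polytope_sum sumx' sumF].
have leface S x' : (@flat_face R n M) F x' -> \sum_(i in S) x' 0 i <= (rk M S)%:R.
  by move=> [PMx' _]; apply: matroid_polytope_sum_le.
have neFT : F != setT by apply: contraTneq rkF_ltd => ->; rewrite ltnn.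
have neF0 : F != set0 by apply: contraTneq rkF_gt0 => ->; rewrite rk_set0.
have d_neq0 : (d%:R : R) != 0 by rewrite pnatr_eq0 -lt0n.
have rkF : (0 < rk M F < #|F|)%N by rewrite rkF_gt0.
have rkFc : (0 < d - rk M F < #|~: F|)%N.
  by rewrite subn_gt0 rkF_ltd ltn_subLR // ltnW.
split=> //.
- move=> S U SU0 SUF modSU.
  have [->|neS0] := eqVneq S set0; first by left.
  have [->|neU0] := eqVneq U set0; first by right.
  suff le : (k.+2 <= n)%N by have := leq_trans le n_le; rewrite ltnn.
  apply: (@affine_rank_two_functionals R n ((@flat_face R n M) F) k d%:R (rk M S)%:R
    (rk M F)%:R S F) => //.
    rewrite properEneq -{2}SUF subsetUl andbT; apply: contraNneq neU0 => eqS.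
    by rewrite -SU0 eqS; apply/eqP/esym/setIidPr; rewrite -SUF subsetUr.
  move=> x' face'; have [sumx' sumF] := sumface _ face'; split=> //.
  have := sum_setUI x' S U; rewrite SUF SU0 big_set0 sumF.
  have := leface S _ face'; have := leface U _ face'.
  have : (rk M S)%:R + (rk M U)%:R = (rk M F)%:R :> R.
    by rewrite -natrD modSU rk_set0.
  lra.
- move=> S U SUF SUT modSU.
  have [->|neSF] := eqVneq S F; first by left.
  have [->|neUF] := eqVneq U F; first by right.
  suff le : (k.+2 <= n)%N by have := leq_trans le n_le; rewrite ltnn.
  apply: (@affine_rank_two_functionals R n ((@flat_face R n M) F) k d%:R (rk M F)%:R
    (rk M S)%:R F S) => //.
  - by rewrite properEneq eq_sym neSF -SUF subsetIl.
  - apply: contraNneq neUF => eqS; rewrite -SUF eqS setTI //.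
  move=> x' face'; have [sumx' sumF] := sumface _ face'; split=> //.
  have := sum_setUI x' S U; rewrite SUF SUT sumF -sumT sumx'.
  have := leface S _ face'; have := leface U _ face'.
  have : (rk M S)%:R + (rk M U)%:R = (rk M F)%:R + d%:R :> R.
    by rewrite -!natrD modSU.
  lra.
Qed.

Lemma chain_point A F : A \subset F -> (0 < rk M A < #|A|)%N ->
  (rk M A < rk M F < rk M A + #|F :\: A|)%N -> (rk M F < d < rk M F + #|~: F|)%N ->
  exists x, [/\ relint Delta x, \sum_(i in A) x 0 i = (rk M A)%:R &
    \sum_(i in F) x 0 i = (rk M F)%:R].
Proof.
move=> AF /andP[rkA0 rkA1] /andP[rkF0 rkF1] /andP[rkd0 rkd1].
(* Each block carries its rank increment, spread evenly. *)
pose a : R := (rk M A)%:R / #|A|%:R.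
pose b : R := (rk M F - rk M A)%:R / #|F :\: A|%:R.
pose c : R := (d - rk M F)%:R / #|~: F|%:R.
have frac01 p q : (0 < p < q)%N -> 0 < (p%:R : R) / q%:R < 1.
  move=> /andP[p0 pq]; have q0 : (0 : R) < q%:R by rewrite ltr0n; lia.
  by rewrite ltr_pdivrMr // mul1r ltr_nat pq andbT divr_gt0 // ltr0n.
have sum_const (y : V) S (t : R) p : (0 < p < #|S|)%N -> t = p%:R / #|S|%:R ->
    (forall i, i \in S -> y 0 i = t) -> \sum_(i in S) y 0 i = p%:R.
  move=> pS -> eqy; rewrite (eq_bigr (fun=> p%:R / #|S|%:R)) //.
  by rewrite sumr_const -[LHS]mulr_natr divfK // pnatr_eq0; lia.
pose x : V := \row_i (if i \in A then a else if i \in F then b else c).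
have sumA : \sum_(i in A) x 0 i = (rk M A)%:R.
  by apply: sum_const; [rewrite rkA0 | reflexivity | move=> i iA; rewrite mxE iA].
have sumFA : \sum_(i in F :\: A) x 0 i = (rk M F - rk M A)%:R.
  apply: sum_const; [lia | reflexivity | move=> i].
  by rewrite inE mxE => /andP[/negPf-> ->].
have sumFc : \sum_(i in ~: F) x 0 i = (d - rk M F)%:R.
  apply: sum_const; [lia | reflexivity | move=> i].
  by rewrite inE mxE => iF; rewrite (negPf iF) (contraNF (subsetP AF i) iF).
have sumF : \sum_(i in F) x 0 i = (rk M F)%:R.
  have := sum_setUI x A (F :\: A); rewrite sumA sumFA.
  have -> : A :&: (F :\: A) = set0 by setdec.
  have -> : A :|: (F :\: A) = F by setdec.
  by rewrite big_set0 addr0 => ->; rewrite -natrD subnKC // ltnW.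
exists x; split=> //; apply/relint_hypersimplexP => //.
  exact: affine_hull_hypersimplex.
split; first by rewrite (sum_setC x F) sumF sumFc -natrD subnKC // ltnW.
move=> i; rewrite mxE; case: ifP => _; last case: ifP => _; apply: frac01; lia.
Qed.

End SplitFlacets.

(** * The two implications *)

Section Main.
Variables (R : realType) (n : nat) (M : matroid 'I_n).
Local Notation V := 'rV[R]_n.
Local Notation d := (rank M).
Local Notation PM := (@matroid_polytope R n M).
Local Notation Delta := (@hypersimplex R n d).
Implicit Types (A F G S : {set 'I_n}) (x : V).
Hypothesis n_ge2 : (2 <= n)%N.
Hypothesis conM : connected_between (rk M) set0 setT.

(** In rank zero every pair is modular, so a singleton and its complement would separate. *)
Lemma connected_rank_gt0 : (0 < d)%N.
Proof.
rewrite lt0n; apply/eqP => d0.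
have rk0 X : rk M X = 0%N.
  by apply/eqP; rewrite -leqn0 -d0; apply/rk_mono/subsetT.
pose i := Ordinal (ltnW n_ge2); pose j := Ordinal n_ge2.
have [|||eqi|eqj] := conM (S := [set i]) (U := ~: [set i]).
- exact: setICr.
- exact: setUCr.
- by rewrite !rk0.
- by have := set11 i; rewrite eqi inE.
by move/setP/(_ j): eqj; rewrite !inE.
Qed.

Let d_gt0 := connected_rank_gt0.

Lemma affine_hull_cube : (affine_hull PM `&` @unit_cube R n)%classic = Delta.
Proof.
have [_ ->] := @bases_span R n M conM d_gt0 PM (@matroid_polytope_basis R n M)
  (@matroid_polytope_sum R n M).
by rewrite classical_sets.setIC.
Qed.

Lemma split_uniform F G x : split_flacet R M F -> split_flacet R M G ->
  uniform_between M set0 F -> uniform_between M F setT -> ~~ (F \subset G) ->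
  relint Delta x -> \sum_(i in F) x 0 i = (rk M F)%:R ->
  \sum_(i in G) x 0 i = (rk M G)%:R -> False.
Proof.
move=> splitF splitG unif0F unifFT nFG.
have [flatF _ _ /andP[rkF0 rkF1] _] := split_flacetE conM d_gt0 splitF.
have [flatG _ _ /andP[rkG0 rkG1] _] := split_flacetE conM d_gt0 splitG.
move=> /(relint_hypersimplexP n_ge2 (affine_hull_hypersimplex R conM d_gt0)) [sumx x01].
move=> sumF sumG; have subm := rk_submod M F G.
have [e eF eG] := subsetPn nFG.
have rkI : rk M (F :&: G) = #|F :&: G|.
  (* As [G] is flat, [e] raises the rank of [G] and so, by submodularity, that of [F :&: G], while
     staying inside [F]. *)
  have ltI : (rk M (F :&: G) < rk M F)%N.
    have := forallP flatG e; rewrite eG /= => lte.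
    have := rk_submod M (e |: F :&: G) G.
    have -> : (e |: F :&: G) :|: G = e |: G.
      by rewrite -setUA setUIl setUid (setIidPr (subsetUr _ _)).
    have -> : (e |: F :&: G) :&: G = F :&: G.
      apply/setP => z; rewrite !inE; have [->|_] := eqVneq z e.
        by rewrite (negPf eG) !andbF.
      by rewrite /= -andbA andbb.
    have : (rk M (e |: F :&: G) <= rk M F)%N.
      by apply: rk_mono; rewrite subUset sub1set eF subsetIl.
    lia.
  have := unif0F (F :&: G) (sub0set _) (subsetIl _ _) ltI.
  by rewrite rk_set0 setD0.
have cFG : #|(F :|: G) :\: F| = #|G :\: F| by rewrite setDUl setDv set0U.
have cG := cardsID F G; rewrite setIC in cG.
have leU : (rk M (F :|: G) <= d)%N by apply/rk_mono/subsetT.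
(* If [F :|: G] is not spanning, it is free over [F]; submodularity then gives [#|G| <= rk M G],
   against [rkG1]. *)
have [ltU|geU] := ltnP (rk M (F :|: G)) d.
  have := unifFT _ (subsetUl F G) (subsetT _) ltU.
  rewrite cFG => rkU; lia.
have rkU : rk M (F :|: G) = d by apply/eqP; rewrite eqn_leq leU.
have := sum_setUI x F G; rewrite sumF sumG => sumUI.
(* The right side is the sum of [x] over [F :|: G] plus that over [F :&: G], at most [d] and
   [#|F :&: G|]. For an interior point these bounds are attained only if [F :|: G] is everything and
   [F :&: G] is empty. *)
have leR : (d%:R + #|F :&: G|%:R : R) <= (rk M F)%:R + (rk M G)%:R.
  by rewrite -!natrD ler_nat -rkU -rkI.
have Uc : \sum_(i in F :|: G) x 0 i + \sum_(i in ~: (F :|: G)) x 0 i = d%:R.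
  by rewrite -sum_setC.
have Uc_ge0 : 0 <= \sum_(i in ~: (F :|: G)) x 0 i.
  by apply: sumr_ge0 => i _; case/andP: (x01 i) => /ltW.
have I_le : \sum_(i in F :&: G) x 0 i <= #|F :&: G|%:R.
  by rewrite -sumr_const; apply: ler_sum => i _; case/andP: (x01 i) => _ /ltW.
have I0 : F :&: G = set0.
  apply/eqP; apply: contraT => /set0Pn[i iFG].
  have : \sum_(k in F :&: G) x 0 k < #|F :&: G|%:R.
    rewrite -sumr_const (bigD1 i) //= [ltRHS](bigD1 i) //=; apply: ltr_leD.
      by case/andP: (x01 i).
    by apply: ler_sum => k _; case/andP: (x01 k) => _ /ltW.
  lra.
have UT : F :|: G = setT.
  apply: setC_inj; rewrite setCT; apply/eqP; apply: contraT => /set0Pn[i iFG].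
  have : 0 < \sum_(k in ~: (F :|: G)) x 0 k.
    rewrite (bigD1 i) //=; apply: ltr_pwDl; first by case/andP: (x01 i).
    by apply: sumr_ge0 => k _; case/andP: (x01 k) => /ltW.
  lra.
have rkFG : (rk M F + rk M G = rk M set0 + rk M setT)%N.
  rewrite rk_set0 add0n; apply/eqP; rewrite -(eqr_nat R) natrD -/(rank M).
  rewrite I0 UT big_set0 in sumUI; rewrite UT setCT big_set0 in Uc.
  by apply/eqP; lra.
have [eqF|eqG] := conM I0 UT rkFG.
  by rewrite eqF rk_set0 in rkF0.
by rewrite eqG rk_set0 in rkG0.
Qed.

Lemma split_compatible F G : split_flacet R M F -> split_flacet R M G -> F <> G ->
  uniform_between M set0 F -> uniform_between M F setT ->
  uniform_between M set0 G -> uniform_between M G setT ->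
  compatible (flat_hyperplane M F) (flat_hyperplane M G) Delta.
Proof.
move=> splitF splitG neFG u0F uFT u0G uGT [x [rx HF HG]].
have sumx : \sum_i x 0 i = d%:R.
  by case/(relint_hypersimplexP n_ge2 (affine_hull_hypersimplex R conM d_gt0)): rx.
move: HF HG => /(flat_hyperplaneE d_gt0 _ sumx) sumF /(flat_hyperplaneE d_gt0 _ sumx) sumG.
have [FG|nFG] := boolP (F \subset G); last exact: split_uniform nFG rx sumF sumG.
have [GF|nGF] := boolP (G \subset F); last exact: split_uniform nGF rx sumG sumF.
by apply: neFG; apply/eqP; rewrite eqEsubset FG.
Qed.

Lemma split_matroid_disjoint F G x : split_flacet R M F -> split_flacet R M G ->
  relint Delta x -> \sum_(i in F) x 0 i = (rk M F)%:R ->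
  \sum_(i in G) x 0 i = (rk M G)%:R -> split_matroid R M -> F <> G -> False.
Proof.
move=> splitF splitG rx sumF sumG splitM neFG.
apply: (splitM F G splitF splitG neFG); exists x; rewrite affine_hull_cube.
have sumx : \sum_i x 0 i = d%:R.
  by case/(relint_hypersimplexP n_ge2 (affine_hull_hypersimplex R conM d_gt0)): rx.
by split=> //; apply/(flat_hyperplaneE d_gt0 _ sumx).
Qed.

Lemma split_matroid_restriction F : split_matroid R M -> split_flacet R M F ->
  uniform_between M set0 F.
Proof.
move=> splitM splitF.
have [flatF con0F conFT /andP[rkF0 rkF1] /andP[rkd0 rkd1]] :=
  split_flacetE conM d_gt0 splitF.
apply: contrapT => /uniform_betweenPn[S [S0 SF ltS depS]].
have [A [[_ AF] con0A conAF]] := connected_nonuniform_split S0 SF con0F ltS depS.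
rewrite rk_set0 add0n setD0 => rkA rkAF.
have AF0 : A != set0 by apply: contraTneq rkA => ->; rewrite rk_set0.
have neFT : F != setT by apply: contraTneq rkd0 => ->; rewrite subnn.
have neF0 : F != set0 by apply: contraTneq rkF0 => ->; rewrite rk_set0.
have rkFd : (rk M F < d < rk M F + #|~: F|)%N by lia.
have [x [rx sumA sumF]] := chain_point R n_ge2 conM d_gt0 AF rkA rkAF rkFd.
have sumx : \sum_i x 0 i = d%:R.
  by case/(relint_hypersimplexP n_ge2 (affine_hull_hypersimplex R conM d_gt0)): rx.
have cF := cardsID A F; rewrite (setIidPr AF) in cF.
have cA := cardsC A; have cFc := cardsC F.
have [conAT|[modA con0 conT]] :=
    ridge_above (rk_submod M) AF AF0 neFT neF0 con0A conAF conFT conM.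
  apply: (split_matroid_disjoint splitF _ rx sumF sumA splitM) => [|eqFA].
    by apply: split_flacetI => //; lia.
  by rewrite eqFA ltnn in rkAF.
have AFc0 : A :&: ~: F = set0 by setdec.
have cU := cardsUI A (~: F); rewrite AFc0 cards0 addn0 in cU.
have cUc := cardsC (A :|: ~: F); rewrite -/(rank M) in modA.
apply: (@split_matroid_disjoint F (A :|: ~: F) x) => //.
- by apply: split_flacetI => //; lia.
(* The sum of [x] over [A :|: ~: F] is [rk M A + d - rk M F], which is the rank of that set by
   [modA]. *)
- have := sum_setUI x A (~: F); rewrite AFc0 big_set0 addr0 => ->.
  apply: (addIr (rk M F)%:R); rewrite -natrD modA natrD -sumx (sum_setC x F) sumA sumF.
  by rewrite -/(rank M); ring.
move=> eqF; case/negP: neFT; apply/eqP.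
have : ~: F \subset F by rewrite {2}eqF subsetUr.
by move=> sub; setdec.
Qed.

Lemma split_matroid_contraction F : split_matroid R M -> split_flacet R M F ->
  uniform_between M F setT.
Proof.
move=> splitM splitF.
have [flatF con0F conFT /andP[rkF0 rkF1] /andP[rkd0 rkd1]] :=
  split_flacetE conM d_gt0 splitF.
apply: contrapT => /uniform_betweenPn[S [FS ST ltS depS]].
have [G [[FG _] conFG conGT rkFG]] := connected_nonuniform_split FS ST conFT ltS depS.
rewrite setTD -/(rank M) => rkG.
have neFT : F != setT by apply: contraTneq rkd0 => ->; rewrite subnn.
have neF0 : F != set0 by apply: contraTneq rkF0 => ->; rewrite rk_set0.
have neGT : G != setT by apply: contraTneq rkG => ->; rewrite -/(rank M) ltnn.
have rkF : (0 < rk M F < #|F|)%N by rewrite rkF0.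
have [x [rx sumF sumG]] := chain_point R n_ge2 conM d_gt0 FG rkF rkFG rkG.
have cG := cardsID F G; rewrite (setIidPr FG) in cG.
have cF := cardsC F; have cGc := cardsC G.
have [con0G|[modG con0 conT]] :=
    ridge_below (rk_submod M) FG neF0 neFT neGT con0F conFG conGT conM.
  apply: (split_matroid_disjoint splitF _ rx sumF sumG splitM) => [|eqFG].
    by apply: split_flacetI => //; lia.
  by rewrite eqFG ltnn in rkFG.
have cGF := cardsC (G :\: F); rewrite rk_set0 addn0 in modG.
apply: (@split_matroid_disjoint F (G :\: F) x) => //.
- by apply: split_flacetI => //; lia.
- have := sum_setUI x (G :\: F) F.
  have -> : (G :\: F) :&: F = set0 by setdec.
  have -> : (G :\: F) :|: F = G by setdec.
  rewrite big_set0 addr0 sumG sumF -modG natrD => /addIr->//.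
move=> eqF; case/negP: neF0; apply/eqP.
by setdec.
Qed.

End Main.

Theorem theorem11 (R : realType) (n : nat) (M : matroid 'I_n) :
  (2 <= n)%N -> connected_matroid M ->
  (split_matroid R M <->
   forall F : {set 'I_n}, split_flacet R M F ->
     uniform_matroid (restriction M F) /\ uniform_matroid (contraction M F)).
Proof.
move=> n_ge2 /connected_matroid_between conM; split=> [splitM F splitF|unif F G].
  split; [apply/uniform_restrictionE | apply/uniform_contractionE].
    exact: split_matroid_restriction splitF.
  exact: split_matroid_contraction splitF.
move=> splitF splitG neFG; rewrite affine_hull_cube //.
have [/uniform_restrictionE u0F /uniform_contractionE uFT] := unif F splitF.
have [/uniform_restrictionE u0G /uniform_contractionE uGT] := unif G splitG.
exact: split_compatible.
Qed.
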